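(* Let $\lambda>0$, and for $P=\mathcal{N}(\mu_1,\Sigma_1)$, $Q=\mathcal{N}(\mu_2,\Sigma_2)$ with $\mu_1,\mu_2\in\mathbb{R}^n$ and $\Sigma_1,\Sigma_2$ positive definite $n\times n$ real matrices let $$C_{\lambda}(P,Q)=\inf_{\pi\in\Pi(P,Q)}\int_{\mathbb{R}^{n}\times \mathbb{R}^{n}}\|x-y\|^2\,\pi(x,y)\,dx\,dy-4\lambda\, \mathrm{Ent}(\pi).$$ Fix $\mu_1$, $\mu_2$, $\Sigma_1$, and all eigenvalues of $\Sigma_2$ (so that $\Sigma_2$ ranges over all positive definite matrices with these prescribed eigenvalues). Let $\Sigma_1=\Gamma^{T}\Lambda_1^{\downarrow}\Gamma$, where $\Lambda_1^{\downarrow}$ is the diagonal matrix of the eigenvalues of $\Sigma_1$ in descending order and $\Gamma$ is an orthogonal matrix. Let $\Lambda_2^{\downarrow}$ and $\Lambda_2^{\uparrow}$ be the diagonal matrices of the eigenvalues of $\Sigma_2$ in descending and ascending order, respectively. Then (i) $C_\lambda(P,Q)$ is minimized by $\Sigma_2=\Gamma^{T}\Lambda_2^{\downarrow}\Gamma$, and (ii) $C_\lambda(P,Q)$ is maximized by $\Sigma_2=\Gamma^{T}\Lambda_2^{\uparrow}\Gamma$. Therefore, neither the minimizer nor the maximizer depends on the choice of $\lambda$.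
   Context: $\Pi(P,Q)$ is the set of couplings of $P$ and $Q$, i.e. probability measures on $\mathbb{R}^n\times\mathbb{R}^n$ with first marginal $P$ and second marginal $Q$, assumed absolutely continuous with respect to Lebesgue measure; a coupling is identified with its Lebesgue density $\pi(x,y)$. $\mathrm{Ent}(\pi)=-\int_{\mathbb{R}^n\times\mathbb{R}^n}\pi(x,y)\log\pi(x,y)\,dx\,dy$ is the Shannon entropy. *)

(* Defs.v *)
(* MathComp / MathComp-Analysis. *)
From HB Require Import structures.
From mathcomp Require Import all_boot all_order all_algebra.
From mathcomp Require Import all_classical all_reals all_analysis.
From mathcomp Require Import measurable_realfun.

Set Implicit Arguments.
Unset Strict Implicit.
Unset Printing Implicit Defensive.

Import Order.TTheory GRing.Theory Num.Theory.

Local Open Scope classical_set_scope.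
Local Open Scope ring_scope.

(* Points of R^n are n-tuples, with the product sigma-algebra of the library;
   [measurableTypeR R] is the copy of R that carries [lebesgue_measure]. *)
Notation rvec R n := (n.-tuple (measurableTypeR R)).

Definition cons_pt (R : realType) (n : nat)
    (p : measurableTypeR R * rvec R n) : rvec R n.+1 := [tuple of p.1 :: p.2].

(* On R^0 this is the unit mass; on R^(n+1) it is the image of the product of
   the Lebesgue measures of R and R^n under R * R^n -> R^(n+1). *)
Fixpoint lebesgue_rvec (R : realType) (n : nat) : set (rvec R n) -> \bar R :=
  match n with
  | 0%N => dirac ([tuple] : rvec R 0)
  | m.+1 => pushforward
      (product_measure1 (@lebesgue_measure R) (@lebesgue_rvec R m))
      (@cons_pt R m)
  end.

Section lebesgue_rvec_measure.
Variable R : realType.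

Lemma measurable_cons_pt n : measurable_fun setT (@cons_pt R n).
Proof.
exact: (@measurable_cons _ _ _ _ fst _ snd measurable_fst measurable_snd).
Qed.

Let behead_pt n (t : rvec R n.+1) : measurableTypeR R * rvec R n :=
  (thead t, [tuple of behead t]).

Let measurable_behead_pt n : measurable_fun setT (@behead_pt n).
Proof.
apply/measurable_fun_pairP; split; first exact: measurable_tnth.
apply/measurable_fun_tnthP => i.
rewrite (_ : _ \o _ = (fun t : rvec R n.+1 => tnth t (lift ord0 i))).
  exact: measurable_tnth.
apply/funext => t /=.
by rewrite [in RHS](tuple_eta t) tnthS.
Qed.

Let behead_ptK n : cancel (@cons_pt R n) (@behead_pt n).
Proof. by move=> [x t]; congr pair; apply: val_inj. Qed.

Lemma lebesgue_rvec_is_measure n :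
  {m : {sigma_finite_measure set (rvec R n) -> \bar R} |
    (m : set (rvec R n) -> \bar R) = @lebesgue_rvec R n}.
Proof.
elim: n => [|n [m mE]] /=; first by exists (dirac ([tuple] : rvec R 0)).
rewrite -mE.
have mc := @measurable_cons_pt n.
pose p : {measure set (rvec R n.+1) -> \bar R} :=
  pushforward (product_measure1 (@lebesgue_measure R) m) (@cons_pt R n).
have sp : sigma_finite setT (p mc).
  have /sigma_finiteP[F [TF ndF Foo]] := sigma_finiteT (@lebesgue_measure R).
  have /sigma_finiteP[G [TG ndG Goo]] := sigma_finiteT m.
  exists (fun i => @behead_pt n @^-1` (F i `*` G i)).
    rewrite -preimage_bigcup; apply/esym/seteqP; split => // t _ /=.
    have [i _ Fi] : (\bigcup_i F i) (thead t) by rewrite -TF.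
    have [j _ Gj] : (\bigcup_i G i) [tuple of behead t] by rewrite -TG.
    exists (maxn i j) => //; split => /=.
    - by move: Fi; exact/subsetPset/ndF/leq_maxl.
    - by move: Gj; exact/subsetPset/ndG/leq_maxr.
  move=> i; have [? ?] := Foo i; have [? ?] := Goo i; split.
    rewrite -[X in measurable X]setTI; apply: measurable_behead_pt => //.
    exact: measurableX.
  rewrite /= /pushforward -comp_preimage (_ : _ \o _ = id) ?preimage_id//.
    by rewrite product_measure1E// lte_mul_pinfty// ge0_fin_numE.
  by apply/funext => x /=; rewrite behead_ptK.
pose sf := isSFinite.Build _ _ _ _ (sfinite_measure_sigma_finite sp).
pose sg := isSigmaFinite.Build _ _ _ _ sp.
pose r : {sigma_finite_measure set (rvec R n.+1) -> \bar R} :=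
  HB.pack (Measure.sort (p mc)) sf sg.
by exists r.
Qed.

Let mu n := sval (lebesgue_rvec_is_measure n).
Let muE n : (mu n : set _ -> _) = @lebesgue_rvec R n.
Proof. exact: (svalP (lebesgue_rvec_is_measure n)). Qed.

Let leb0 n : @lebesgue_rvec R n set0 = 0%E.
Proof. by rewrite -muE measure0. Qed.
Let leb_ge0 n A : (0 <= @lebesgue_rvec R n A)%E.
Proof. by rewrite -muE measure_ge0. Qed.
Let leb_sa n : semi_sigma_additive (@lebesgue_rvec R n).
Proof. by rewrite -muE; exact: measure_semi_sigma_additive. Qed.
HB.instance Definition _ n := isMeasure.Build _ _ _
  (@lebesgue_rvec R n) (@leb0 n) (@leb_ge0 n) (@leb_sa n).

Let leb_sf n : sigma_finite setT (@lebesgue_rvec R n).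
Proof. by rewrite -muE; exact: sigma_finiteT. Qed.
HB.instance Definition _ n := Measure_isSigmaFinite.Build _ _ _
  (@lebesgue_rvec R n) (@leb_sf n).

End lebesgue_rvec_measure.

Definition gauss_pdf (R : realType) (n : nat) (m : 'cV[R]_n) (S : 'M[R]_n)
    (x : rvec R n) : R :=
  let v := \col_i tnth x i - m in
  (Num.sqrt ((2 * pi) ^+ n * \det S))^-1 *
  expR (- ((v^T *m invmx S *m v) 0 0 / 2)).

(* The normal distribution N(m, S), meaningful for S positive definite. *)
Definition gauss (R : realType) (n : nat) (m : 'cV[R]_n) (S : 'M[R]_n) :
    set (rvec R n) -> \bar R :=
  fun A => (\int[@lebesgue_rvec R n]_(x in A) (gauss_pdf m S x)%:E)%E.

Section gauss_measure.
Variables (R : realType) (n : nat) (m : 'cV[R]_n) (S : 'M[R]_n).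

Lemma gauss_pdf_ge0 x : 0 <= gauss_pdf m S x.
Proof. by rewrite mulr_ge0 ?invr_ge0 ?sqrtr_ge0 ?expR_ge0. Qed.

Lemma measurable_gauss_pdf :
  measurable_fun [set: rvec R n] (gauss_pdf m S).
Proof.
apply: measurable_funM => //.
apply: measurableT_comp => //; apply: measurableT_comp => //.
apply: measurable_funM => //.
have mv i : measurable_fun [set: rvec R n] (fun x : rvec R n => tnth x i - m i 0).
  by apply: measurable_funB => //; exact: measurable_tnth.
pose q (x : rvec R n) :=
  \sum_j (\sum_k (tnth x k - m k 0) * invmx S k j) * (tnth x j - m j 0).
suff mq : measurable_fun setT q.
  apply: eq_measurable_fun mq => x _; rewrite /q mxE; apply: eq_bigr => j _.
  by rewrite !mxE; congr (_ * _); apply: eq_bigr => k _; rewrite !mxE.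
apply: measurable_sum => j; apply: measurable_funM => //.
by apply: measurable_sum => k; exact: measurable_funM.
Qed.

Let gauss0 : gauss m S set0 = 0%E.
Proof. by rewrite /gauss integral_set0. Qed.

Let gauss_ge0 A : (0 <= gauss m S A)%E.
Proof. by apply: integral_ge0 => x _; rewrite lee_fin gauss_pdf_ge0. Qed.

Let gauss_sigma_additive : semi_sigma_additive (gauss m S).
Proof.
move=> F mF tF mUF; rewrite /gauss ge0_integral_bigcup//=.
- apply: is_cvg_ereal_nneg_natsum_cond => k _ _.
  by apply: integral_ge0 => x _; rewrite lee_fin gauss_pdf_ge0.
- apply/measurable_funTS/measurable_EFinP; exact: measurable_gauss_pdf.
- by move=> x _; rewrite lee_fin gauss_pdf_ge0.
Qed.

HB.instance Definition _ := isMeasure.Build _ _ _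
  (gauss m S) gauss0 gauss_ge0 gauss_sigma_additive.

End gauss_measure.

Section entropic_transport.
Variables (R : realType) (n : nat).

Definition lebesgue_rvec2 : set (rvec R n * rvec R n) -> \bar R :=
  product_measure1 (@lebesgue_rvec R n) (@lebesgue_rvec R n).
HB.instance Definition _ := Measure.on lebesgue_rvec2.

Definition couplings (P Q : {measure set (rvec R n) -> \bar R}) :
    set (probability (rvec R n * rvec R n)%type R) :=
  [set p : probability (rvec R n * rvec R n)%type R |
    [/\ forall A, measurable A -> pushforward p fst A = P A,
        forall A, measurable A -> pushforward p snd A = Q A &
        p `<< lebesgue_rvec2]].

Definition is_density (p : probability (rvec R n * rvec R n)%type R)
    (f : rvec R n * rvec R n -> R) : Prop :=
  [/\ measurable_fun setT f, forall z, 0 <= f z &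
      forall A, measurable A -> p A = (\int[lebesgue_rvec2]_(z in A) (f z)%:E)%E].

(* [ln 0 = 0], so the integrand vanishes where [f] does. The negative part of
   [f ln f] is integrable when the marginals of [f] have second moments, so the
   integral is then well defined, possibly [+oo]. *)
Definition Ent (f : rvec R n * rvec R n -> R) : \bar R :=
  (- \int[lebesgue_rvec2]_z (f z * ln (f z))%:E)%E.

Definition sqdist (x y : rvec R n) : R := \sum_i (tnth x i - tnth y i) ^+ 2.

Definition eot_cost (lambda : R) (P Q : {measure set (rvec R n) -> \bar R}) :
    \bar R :=
  ereal_inf [set c | exists (p : probability (rvec R n * rvec R n)%type R) f,
    [/\ couplings P Q p, is_density p f &
        c = (\int[lebesgue_rvec2]_z (sqdist z.1 z.2 * f z)%:E
               - (4 * lambda)%:E * Ent f)%E]].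

End entropic_transport.

Section spectrum.
Variables (R : realType) (n : nat).

Definition posdefmx (S : 'M[R]_n) : Prop :=
  S^T = S /\ forall x : 'cV[R]_n, x != 0 -> 0 < (x^T *m S *m x) 0 0.

Definition orthogonal_mx (G : 'M[R]_n) : Prop := G^T *m G = 1%:M.

(* [s] lists the eigenvalues of [S] with multiplicity, in arbitrary order. *)
Definition eigenvalues_of (S : 'M[R]_n) (s : n.-tuple R) : Prop :=
  char_poly S = \prod_(x <- s) ('X - x%:P).

Definition diag_desc (s : n.-tuple R) : 'M[R]_n :=
  diag_mx (\row_(i < n) (sort >=%R s)`_i).

Definition diag_asc (s : n.-tuple R) : 'M[R]_n :=
  diag_mx (\row_(i < n) (sort <=%R s)`_i).

Definition isospectral_posdef (s : n.-tuple R) : set 'M[R]_n :=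
  [set S | posdefmx S /\ eigenvalues_of S s].

End spectrum.

Definition minimizes (T : Type) (R : realType) (F : T -> \bar R) (A : set T)
    (a : T) : Prop := A a /\ forall b, A b -> (F a <= F b)%E.

Definition maximizes (T : Type) (R : realType) (F : T -> \bar R) (A : set T)
    (a : T) : Prop := A a /\ forall b, A b -> (F b <= F a)%E.

(* Main.v *)
Require Import Defs.
From HB Require Import structures.
From mathcomp Require Import all_boot all_order all_algebra all_fingroup.
From mathcomp Require Import complex.
From mathcomp Require Import all_classical all_reals all_analysis.
From mathcomp Require Import measurable_realfun.
From mathcomp Require Import ring lra.

Set Implicit Arguments.
Unset Strict Implicit.
Unset Printing Implicit Defensive.

Import Order.TTheory GRing.Theory Num.Theory.

Local Open Scope classical_set_scope.
Local Open Scope ring_scope.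

(** Let y_1, ..., y_n be the eigenvalues of S1 S2, equivalently of L^T S2 L
    whenever S1 = L L^T, and let c = 1 / (2 lambda).  The proof has two halves.

    Value of the cost.  The optimal cost is a term depending only on lambda, the
    means and the traces of S1 and S2, plus 2 lambda times the sum of the numbers
    [spectral_cost c y_i] ([eot_cost_gauss]).  Indeed, for a positive density rho
    Gibbs' inequality reads f ln f >= f ln rho + f - rho.  If moreover
    |x - y|^2 + 4 lambda ln rho (x, y) splits as phi x + psi y, the cost of a
    coupling with density f is at least the integral of phi against P plus that
    of psi against Q, a quantity that depends on the marginals alone, with
    equality for f = rho as soon as rho is itself a coupling density
    ([eot_cost_dual]).  For Gaussian marginals the right rho is the Gaussian
    density whose precision matrix has off-diagonal blocks -c.  In a basis where
    S1 = P P^T and S2 = P^-T diag(y) P^-1 the conditions on its marginals decouple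
    into the scalar equations t + c^2 t^2 = y_i, which [tau] solves.  The integrals
    of quadratic polynomials that remain are computed by induction on the
    dimension, conditioning the first coordinate on the others.

    Comparison of the spectra.  The eigenvalues of S2 being prescribed, its trace
    is too, and only the y_i vary.  As a function of ln y the number
    [spectral_cost c y] is concave and decreasing, so a sum of such numbers
    decreases when the partial sums of the sorted ln y_i increase
    ([sum_spectral_cost_le]).  Those partial sums are controlled by the
    multiplicative Lidskii inequality [lidskii_mul].  Applied to the product of S1
    and S2, it bounds them above by those of the products of the eigenvalues
    paired in the same order, which gives the minimum.  Applied to S2^-1 and
    diag(y), from which S1 is recovered as M^T diag(y) M with M^T M = S2^-1, it bounds
    them below by those of the products paired in opposite orders, which gives the
    maximum.  Since lambda enters only through the function, the extremal matrices
    are the same for all lambda. *)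

(** * Spectral theorem for real symmetric matrices *)

Section real_spectral_theorem.

Variable R : realType.

(** Over the complex numbers there is an eigenvalue z with eigenvector w.  Since S
    is Hermitian, w S w^* = z |w|^2 is real; hence so is z, and a real root of the
    characteristic polynomial has a real eigenvector. *)
Lemma sym_has_eigenvector n (S : 'M[R]_n.+1) : S^T = S ->
  exists (a : R) (v : 'rV[R]_n.+1), v != 0 /\ v *m S = a *: v.
Proof.
move=> S_sym.
pose f : {rmorphism R -> R[i]} := real_complex R.
have [z zS] := @spectral.eigenvalue_closed R[i] n.+1 (map_mx f S) (ltn0Sn n).
have /eigenvalueP[w wS w0] := zS.
have fC x : (f x)^* = f x by apply: conjc_real.
have zR : z^* = z.
  have : (w *m map_mx f S *m (map_mx Num.conj w)^T) 0 0 =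
      z * (w *m (map_mx Num.conj w)^T) 0 0.
    by rewrite wS -scalemxAl mxE.
  set q := (_ *m _) 0 0.
  set N := (w *m _) 0 0 => qE.
  have NE : N = \sum_i `|w 0 i| ^+ 2.
    by rewrite /N mxE; apply: eq_bigr => i _; rewrite !mxE normCK.
  have N0 : N != 0.
    rewrite NE; apply: contra w0; rewrite psumr_eq0; last by move=> i _; rewrite exprn_ge0.
    move=> /allP w0; apply/eqP/rowP => i; have := w0 i (mem_index_enum i).
    by rewrite expf_eq0 normr_eq0 /= mxE => /eqP.
  have NC : N^* = N.
    by rewrite NE rmorph_sum; apply: eq_bigr => i _; rewrite rmorphXn /= conj_normC.
  have qC : q^* = q.
    rewrite /q !mxE rmorph_sum /=.
    under eq_bigr do rewrite mxE rmorphM rmorph_sum /= mulr_suml.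
    rewrite exchange_big; apply: eq_bigr => i _ /=.
    rewrite !mxE mulr_suml; apply: eq_bigr => j _ .
    rewrite !mxE rmorphM conjCK /= fC -{2}S_sym mxE; ring.
  apply: (mulIf N0); rewrite -qE -{1}NC -rmorphM -qE //.
have {}zR : z = f (complex.Re z).
  case: z zR {zS wS} => x y /= [/eqP].
  by rewrite -subr_eq0 -opprD oppr_eq0 -mulr2n mulrn_eq0 => /eqP /= ->.
move: zS; rewrite eigenvalue_root_char -map_char_poly zR fmorph_root.
rewrite -eigenvalue_root_char => /eigenvalueP[v vS v0].
by exists (complex.Re z), v.
Qed.

Lemma orthogonal_mxC n (G : 'M[R]_n) : orthogonal_mx G -> G *m G^T = 1%:M.
Proof. by move=> /mulmx1C. Qed.

Lemma orthogonal_mxM n (G H : 'M[R]_n) :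
  orthogonal_mx G -> orthogonal_mx H -> orthogonal_mx (G *m H).
Proof.
by move=> Go Ho; rewrite /orthogonal_mx trmx_mul mulmxA -(mulmxA H^T) Go mulmx1.
Qed.

(** The Householder reflection that exchanges the first basis vector and v. *)
Lemma unit_row_extends n (v : 'rV[R]_n.+1) : v *m v^T = 1%:M ->
  exists2 H : 'M[R]_n.+1, orthogonal_mx H & delta_mx 0 0 *m H = v.
Proof.
move=> v1; pose e : 'rV[R]_n.+1 := delta_mx 0 0.
have e1 : e *m e^T = 1%:M.
  by apply/rowP => i; rewrite ord1 trmx_delta mul_delta_mx !mxE.
have [->|ve] := eqVneq v e.
  by exists 1%:M; rewrite ?mulmx1 // /orthogonal_mx trmx1 mulmx1.
pose w := v - e.
have evC : v *m e^T = e *m v^T 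
  by apply/rowP => i; rewrite ord1 !mxE; apply: eq_bigr => j _; rewrite !mxE mulrC.
pose t := (e *m v^T) 0 0.
have evE : e *m v^T = t%:M by rewrite [LHS]mx11_scalar.
have ww : w *m w^T = (2 * (1 - t))%:M.
  rewrite linearB /= mulmxBl !mulmxBr v1 e1 evC evE.
  by rewrite -!raddfB; congr _%:M; ring.
have ew : e *m w^T = (t - 1)%:M by rewrite linearB /= mulmxBr e1 evE -raddfB.
have t1 : 1 - t != 0.
  apply: contra ve => /eqP t1; rewrite -subr_eq0 -/w.
  have : (w *m w^T) 0 0 = 0 by rewrite ww t1 mulr0 !mxE eqxx.
  rewrite mxE => /eqP; rewrite psumr_eq0; last first.
    by move=> i _; rewrite [_^T _ _]mxE -expr2 sqr_ge0.
  move=> /allP w0; apply/eqP/rowP => i; have := w0 i (mem_index_enum i).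
  by rewrite [_^T _ _]mxE mulf_eq0 orbb => /eqP ->; rewrite mxE.
pose H := 1%:M - (1 - t)^-1 *: (w^T *m w).
have HT : H^T = H by rewrite linearB /= trmx1 linearZ /= trmx_mul trmxK.
exists H.
  rewrite /orthogonal_mx HT mulmxBl mul1mx mulmxBr mulmx1 -scalemxAl -scalemxAr.
  rewrite mulmxA -(mulmxA w^T) ww mul_mx_scalar -scalemxAl !scalerA.
  rewrite (_ : _ * _ = (1 - t)^-1 + (1 - t)^-1); last by field.
  by rewrite scalerDl opprB addrK subrK.
rewrite -/e mulmxBr mulmx1 -scalemxAr mulmxA ew mul_scalar_mx scalerA.
rewrite (_ : _ * _ = -1); last by field.
by rewrite scaleN1r opprK addrC subrK.
Qed.

(** By induction: in an orthonormal basis that starts with an eigenvector, the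
    first row of S is a multiple of the first basis vector, and by symmetry S is
    block diagonal. *)
Theorem real_spectral n (S : 'M[R]_n) : S^T = S ->
  exists (G : 'M[R]_n) (d : 'rV[R]_n),
    orthogonal_mx G /\ S = G^T *m diag_mx d *m G.
Proof.
elim: n S => [|n IH] S S_sym.
  by exists 1%:M, 0; split; apply/matrixP => -[].
have [a [v [v0 vS]]] := sym_has_eigenvector S_sym.
pose q := (v *m v^T) 0 0.
have vvE : v *m v^T = q%:M by rewrite [LHS]mx11_scalar.
have nv : 0 < q.
  rewrite lt_neqAle eq_sym; apply/andP; split; last first.
    by rewrite /q mxE sumr_ge0 // => i _; rewrite [_^T _ _]mxE -expr2 sqr_ge0.
  rewrite /q mxE psumr_eq0; last by move=> i _; rewrite [_^T _ _]mxE -expr2 sqr_ge0.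
  apply: contra v0 => /allP v0; apply/eqP/rowP => i; have := v0 i (mem_index_enum i).
  by rewrite [_^T _ _]mxE mulf_eq0 orbb => /eqP ->; rewrite mxE.
pose u := (Num.sqrt q)^-1 *: v.
have u1 : u *m u^T = 1%:M.
  rewrite linearZ /= -scalemxAl -scalemxAr scalerA -expr2 exprVn sqr_sqrtr ?ltW//.
  by rewrite vvE scale_scalar_mx mulVf ?gt_eqF.
have uS : u *m S = a *: u by rewrite -scalemxAl vS scalerA mulrC -scalerA.
have [H Ho He] := unit_row_extends u1.
pose T : 'M[R]_(1 + n) := H *m S *m H^T.
have TH : T = H *m S *m H^T by [].
have TT : T^T = T by rewrite /T !trmx_mul trmxK S_sym mulmxA.
pose e : 'rV[R]_(1 + n) := delta_mx 0 0.
have eT : e *m T = a *: e.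
  by rewrite /T !mulmxA He uS -scalemxAl -He -mulmxA orthogonal_mxC// mulmx1.
have Ti i : T 0 i = a * (i == 0)%:R.
  by have := congr1 (fun A : 'rV_(1 + n) => A 0 i) eT; rewrite /e -rowE !mxE eqxx.
clearbody T.
have l0 : lshift n (0 : 'I_1) = (0 : 'I_(1 + n)) by exact: val_inj.
have TE : T = block_mx a%:M 0 0 (drsubmx T).
  rewrite -[LHS]submxK; congr block_mx.
  - apply/matrixP => i j; rewrite !mxE !ord1 l0.
    by rewrite Ti !eqxx mulr1.
  - apply/matrixP => i j; rewrite !mxE !ord1 l0.
    by rewrite Ti mulr0.
  - apply/matrixP => i j; rewrite !mxE !ord1 l0.
    by rewrite -TT mxE Ti mulr0.
have [] := IH (drsubmx T).
  by rewrite trmx_drsub TT.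
move=> G' [d' [Go' dE]].
pose K : 'M[R]_(1 + n) := block_mx 1%:M 0 0 G'.
have Ko : orthogonal_mx K.
  rewrite /orthogonal_mx /K tr_block_mx mulmx_block.
  by rewrite !trmx0 trmx1 !mul0mx !mulmx0 !addr0 add0r mulmx1 Go' -scalar_mx_block.
have KTK : K^T *m diag_mx (row_mx a%:M d') *m K = T.
  rewrite TE dE diag_mx_row /K tr_block_mx !mulmx_block.
  rewrite !trmx0 trmx1 !(mul0mx,mulmx0,addr0,add0r,mulmx1,mul1mx).
  by congr block_mx; apply/matrixP => i j; rewrite !ord1 !mxE eqxx.
exists (K *m H), (row_mx a%:M d'); split; first exact: (orthogonal_mxM Ko Ho).
rewrite trmx_mul.
transitivity (H^T *m T *m H).
  rewrite TH !mulmxA Ho mul1mx -mulmxA Ho mulmx1 //.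
by rewrite -KTK !mulmxA.
Qed.

End real_spectral_theorem.

(** * Spectra of symmetric matrices *)

Definition diag_of (R : realType) n (a : 'I_n -> R) : 'M[R]_n :=
  diag_mx (\row_i a i).

Definition qform (R : realType) n (Q : 'M[R]_n) (u : 'cV[R]_n) : R :=
  (u^T *m Q *m u) 0 0.

(** The eigenvalues come in a specific order, so a matrix has several spectra,
    obtained from one another by permutation. *)
Definition has_spectrum (R : realType) n (S : 'M[R]_n) (a : 'I_n -> R) :=
  exists2 G : 'M[R]_n, orthogonal_mx G & S = G^T *m diag_of a *m G.

Definition antitone (R : realType) n (a : 'I_n -> R) :=
  forall i j : 'I_n, (i <= j)%N -> a j <= a i.

Section spectrum_theory.

Variables (R : realType) (n : nat).
Implicit Types (S G Q L B : 'M[R]_n) (a b y : 'I_n -> R) (u x : 'cV[R]_n).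

Lemma diag_ofM a b : diag_of a *m diag_of b = diag_of (fun i => a i * b i).
Proof. by rewrite /diag_of mulmx_diag; congr diag_mx; apply/rowP => i; rewrite !mxE. Qed.

Lemma eq_diag_of a b : a =1 b -> diag_of a = diag_of b.
Proof. by move=> ab; congr diag_mx; apply/rowP => i; rewrite !mxE. Qed.

Lemma diag_of1 : diag_of (fun _ => 1 : R) = 1%:M :> 'M[R]_n.
Proof. by rewrite -diag_const_mx; congr diag_mx; apply/rowP => i; rewrite !mxE. Qed.

Lemma diag_ofT a : (diag_of a)^T = diag_of a. Proof. exact: tr_diag_mx. Qed.

Lemma diag_of_mulV a : (forall i, a i != 0) -> diag_of a *m diag_of (fun i => (a i)^-1) = 1%:M.
Proof. by move=> a0; rewrite diag_ofM -diag_of1; apply: eq_diag_of => i; rewrite mulfV. Qed.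

Lemma det_diag_of a : \det (diag_of a) = \prod_i a i.
Proof. by rewrite det_diag; apply: eq_bigr => i _; rewrite mxE. Qed.

Lemma qform_diag_of a u : qform (diag_of a) u = \sum_i a i * u i 0 ^+ 2.
Proof.
rewrite /qform mul_mx_diag mxE; apply: eq_bigr => i _; rewrite !mxE; ring.
Qed.

Lemma qform_conj m (L : 'M[R]_(m, n)) (Q : 'M[R]_m) u :
  qform (L^T *m Q *m L) u = qform Q (L *m u).
Proof. by rewrite /qform trmx_mul !mulmxA. Qed.

Lemma qform0 Q : qform Q 0 = 0. Proof. by rewrite /qform mulmx0 mxE. Qed.

Lemma posdef_conj L S : L \in unitmx -> posdefmx S -> posdefmx (L^T *m S *m L).
Proof.
move=> Lu [ST Sp]; split; first by rewrite !trmx_mul trmxK ST mulmxA.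
move=> x x0; rewrite -/(qform _ _) qform_conj; apply: Sp.
by apply: contra x0 => /eqP Lx; rewrite -(mulKmx Lu x) Lx mulmx0.
Qed.

Lemma posdef_diag_of a : (forall i, 0 < a i) -> posdefmx (diag_of a).
Proof.
move=> a0; split; first exact: diag_ofT.
move=> x x0; rewrite -/(qform _ _) qform_diag_of lt_neqAle eq_sym; apply/andP; split.
  rewrite psumr_eq0; last by move=> i _; rewrite mulr_ge0 ?sqr_ge0 ?ltW.
  apply: contra x0 => /allP x0; apply/eqP/colP => i; have := x0 i (mem_index_enum i).
  by rewrite mulf_eq0 gt_eqF//= sqrf_eq0 mxE => /eqP.
by apply: sumr_ge0 => i _; rewrite mulr_ge0 ?sqr_ge0 ?ltW.
Qed.

Lemma orthogonal_unitmx G : orthogonal_mx G -> G \in unitmx.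
Proof. by move=> /mulmx1_unit[]. Qed.

Lemma posdef_spectrum S a : has_spectrum S a -> posdefmx S <-> forall i, 0 < a i.
Proof.
move=> [G Go SE]; split => [[_ Sp] i|a0]; last first.
  by rewrite SE; apply: posdef_conj; [exact: orthogonal_unitmx|exact: posdef_diag_of].
have := Sp (G^T *m delta_mx i 0); rewrite -/(qform _ _) SE qform_conj mulmxA.
rewrite orthogonal_mxC// mul1mx qform_diag_of (bigD1 i)//= big1 ?addr0.
  rewrite mxE !eqxx expr1n mulr1; apply.
  apply/negP => /eqP /(congr1 (mulmx G)); rewrite mulmxA orthogonal_mxC// mul1mx mulmx0.
  by move=> /matrixP/(_ i 0)/eqP; rewrite !mxE !eqxx oner_eq0.
by move=> j ji; rewrite mxE (negbTE ji) expr0n mulr0.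
Qed.

Lemma has_spectrum_perm S a (p : 'S_n) : has_spectrum S a -> has_spectrum S (a \o p).
Proof.
move=> [G Go ->]; exists (perm_mx p *m G).
  apply: orthogonal_mxM => //.
  by rewrite /orthogonal_mx tr_perm_mx -perm_mxM mulVg perm_mx1.
have key : (perm_mx p)^T *m diag_of (a \o p) *m perm_mx p = diag_of a.
  rewrite tr_perm_mx -row_permE -[p in perm_mx p]invgK -col_permE.
  apply/matrixP => i j; rewrite !mxE /= permKV.
  by rewrite (inj_eq (@perm_inj _ _)).
by rewrite -key trmx_mul !mulmxA.
Qed.

Lemma det_orthogonal_sqr G : orthogonal_mx G -> \det G * \det G = 1.
Proof. by move=> /(congr1 (@determinant _ _)); rewrite det_mulmx det_tr det1. Qed.

Lemma det_spectrum S a : has_spectrum S a -> \det S = \prod_i a i.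
Proof.
by move=> [G Go ->]; rewrite !det_mulmx det_tr mulrAC det_orthogonal_sqr// mul1r det_diag_of.
Qed.

Lemma char_poly_spectrum S a : has_spectrum S a ->
  char_poly S = \prod_i ('X - (a i)%:P).
Proof.
move=> [G Go SE].
have pG : map_mx polyC G^T *m map_mx polyC G = 1%:M by rewrite -map_mxM Go map_mx1.
have : char_poly_mx S = (map_mx polyC G^T *m char_poly_mx (diag_of a) *m map_mx polyC G).
  rewrite /char_poly_mx mulmxBr mulmxBl mul_mx_scalar -scalemxAl pG scalemx1.
  by rewrite -!map_mxM -SE.
move=> /(congr1 (@determinant _ _)); rewrite -/(char_poly S) => ->.
rewrite !det_mulmx mulrAC -det_mulmx pG det1 mul1r.
rewrite -/(char_poly (diag_of a)) (char_poly_trig (diag_mx_is_trig _)).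
by apply: eq_bigr => i _; rewrite !mxE eqxx mulr1n.
Qed.

(** The characteristic polynomial determines the eigenvalues up to order, and
    reordering them only permutes the eigenvectors. *)
Lemma eigenvalues_has_spectrum S (s : n.-tuple R) (t : seq R) :
  S^T = S -> eigenvalues_of S s -> perm_eq t s ->
  has_spectrum S (fun i => t`_i).
Proof.
move=> /real_spectral[G [d [Go SE]]] Ss ts.
have Sd : has_spectrum S (d 0).
  exists G => //; rewrite SE /diag_of; congr (_ *m diag_mx _ *m _).
  by apply/rowP => i; rewrite mxE.
have /(prod_XsubC_eq) ds :
    \prod_(x <- [tuple d 0 i | i < n]) ('X - x%:P) = \prod_(x <- s) ('X - x%:P).
  rewrite -[RHS]Ss (char_poly_spectrum Sd) big_tuple.
  by apply: eq_bigr => i _; rewrite tnth_mktuple.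
rewrite perm_sym in ds; have /tuple_permP[p tE] := perm_trans ts ds.
suff -> : (fun i : 'I_n => t`_i) = d 0 \o p by exact: has_spectrum_perm.
by apply/funext => i /=; rewrite tE nth_mktuple tnth_mktuple.
Qed.

Lemma antitone_desc (s : n.-tuple R) : antitone (fun i : 'I_n => (sort >=%R s)`_i).
Proof.
move=> i j ij.
have ge_tr : transitive (>=%R : rel R) by move=> y x z yx zy; exact: le_trans zy yx.
have ge_tot : total (>=%R : rel R) by move=> x y; exact: le_total.
apply: (sorted_leq_nth ge_tr (@lexx _ R) 0 (sort_sorted ge_tot s)) => //.
- by rewrite inE size_sort size_tuple.
- by rewrite inE size_sort size_tuple.
Qed.

Lemma sym_spectrum S : S^T = S -> exists2 a, antitone a & has_spectrum S a.
Proof.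
move=> ST; have [G [d [Go SE]]] := real_spectral ST.
pose s := [tuple d 0 i | i < n].
have Ss : eigenvalues_of S s.
  rewrite /eigenvalues_of (@char_poly_spectrum _ (d 0)).
    by rewrite big_tuple; apply: eq_bigr => i _; rewrite tnth_mktuple.
  exists G => //; rewrite SE; congr (_ *m diag_mx _ *m _); apply/rowP => i; rewrite mxE //.
exists (fun i => (sort >=%R s)`_i); first exact: antitone_desc.
by apply: eigenvalues_has_spectrum Ss _ => //; rewrite perm_sort.
Qed.

End spectrum_theory.

Section quadratic_forms.

Variable R : realType.

Lemma trmx_conj_sym n (L S : 'M[R]_n) : S^T = S ->
  (L^T *m S *m L)^T = L^T *m S *m L.
Proof. by move=> ST; rewrite !trmx_mul trmxK ST mulmxA. Qed.

Lemma posdef1 n : posdefmx (1%:M : 'M[R]_n).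
Proof. by rewrite -diag_of1; apply: posdef_diag_of => i. Qed.

Lemma posdef_gram n (L : 'M[R]_n) : L \in unitmx -> posdefmx (L^T *m L).
Proof. by move=> Lu; have := posdef_conj Lu (posdef1 n); rewrite mulmx1. Qed.

Lemma posdef_det_gt0 n (S : 'M[R]_n) : posdefmx S -> 0 < \det S.
Proof.
move=> S_pos; have [a _ Sa] := sym_spectrum S_pos.1.
by rewrite (det_spectrum Sa) prodr_gt0// => i _; apply: (posdef_spectrum Sa).1.
Qed.

Lemma posdef_unitmx n (S : 'M[R]_n) : posdefmx S -> S \in unitmx.
Proof. by move=> /posdef_det_gt0 S0; rewrite unitmxE unitfE gt_eqF. Qed.

Lemma invmx_eq n (S W : 'M[R]_n) : S *m W = 1%:M -> invmx S = W.
Proof.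
move=> SW; have [Su _] := mulmx1_unit SW.
by rewrite -[RHS](mulKmx Su) SW mulmx1.
Qed.

Lemma qformD n (Q : 'M[R]_n) u z : qform Q (u + z) =
  qform Q u + ((u^T *m Q *m z) 0 0 + (z^T *m Q *m u) 0 0) + qform Q z.
Proof.
have addE (A B : 'M[R]_1) : (A + B) 0 0 = A 0 0 + B 0 0 by rewrite mxE.
rewrite /qform mulmxDr [(u + z)^T]linearD /= !mulmxDl !addE; ring.
Qed.

Lemma qformZ n (Q : 'M[R]_n) (s : R) u : qform Q (s *: u) = s ^+ 2 * qform Q u.
Proof.
by rewrite /qform [(s *: u)^T]linearZ /= -scalemxAr -!scalemxAl scalerA mxE expr2.
Qed.

Lemma qform1E n (u : 'cV[R]_n) : qform 1%:M u = \sum_i u i 0 ^+ 2.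
Proof. by rewrite -diag_of1 qform_diag_of; apply: eq_bigr => i _; rewrite mul1r. Qed.

Lemma qform_addmx n (Q1 Q2 : 'M[R]_n) u : qform (Q1 + Q2) u = qform Q1 u + qform Q2 u.
Proof. by rewrite /qform mulmxDr mulmxDl mxE. Qed.

Lemma qform_scalemx n (k : R) (Q : 'M[R]_n) u : qform (k *: Q) u = k * qform Q u.
Proof. by rewrite /qform -scalemxAr -scalemxAl mxE. Qed.

Lemma qform_submx n (k : R) (Q1 Q2 : 'M[R]_n) u :
  qform (Q1 - k *: Q2) u = qform Q1 u - k * qform Q2 u.
Proof. by rewrite qform_addmx -scaleNr qform_scalemx mulNr. Qed.

Lemma trace_spectrum n (S : 'M[R]_n) a : has_spectrum S a -> \tr S = \sum_i a i.
Proof.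
move=> [G Go ->]; rewrite mxtrace_mulC mulmxA orthogonal_mxC// mul1mx.
by apply: eq_bigr => i _; rewrite !mxE eqxx mulr1n.
Qed.

Lemma has_spectrum_diag_of n (a : 'I_n -> R) : has_spectrum (diag_of a) a.
Proof.
by exists 1%:M; rewrite /orthogonal_mx ?trmx1 mul1mx ?mulmx1.
Qed.

Lemma has_spectrumZ n (S : 'M[R]_n) a (c : R) : has_spectrum S a ->
  has_spectrum (c *: S) (fun i => c * a i).
Proof.
move=> [G Go ->]; exists G => //; rewrite scalemxAl scalemxAr; congr (_ *m _ *m _).
by rewrite /diag_of -linearZ /=; congr diag_mx; apply/rowP => i; rewrite !mxE.
Qed.

Lemma has_spectrum_invmx n (S : 'M[R]_n) a : (forall i, 0 < a i) -> has_spectrum S a ->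
  has_spectrum (invmx S) (fun i => (a i)^-1).
Proof.
move=> a0 [G Go SE]; exists G => //; apply: invmx_eq; rewrite SE !mulmxA.
rewrite -(mulmxA _ G) orthogonal_mxC// mulmx1 -(mulmxA G^T) diag_of_mulV ?mulmx1//.
by move=> i; rewrite gt_eqF.
Qed.

End quadratic_forms.

(** * Monotonicity of eigenvalues and the multiplicative Lidskii inequality *)

Lemma ln_prod (R : realType) (I : finType) (F : I -> R) : (forall i, 0 < F i) ->
  ln (\prod_i F i) = \sum_i ln (F i).
Proof.
move=> F0; pose P (x z : R) := 0 < x /\ ln x = z.
suff [] : P (\prod_i F i) (\sum_i ln (F i)) by [].
elim/big_rec2: _ => [|i x z _ [x0 <-]]; first by split; rewrite ?ln1.
by split; rewrite ?mulr_gt0// lnM ?posrE.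
Qed.

Section eigenvalue_inequalities.

Variables (R : realType) (n : nat).
Implicit Types (S T G Q L B : 'M[R]_n) (a b y : 'I_n -> R) (u x : 'cV[R]_n).

Lemma qform_diag_of_le a b u : (forall i, a i * u i 0 ^+ 2 <= b i * u i 0 ^+ 2) ->
  qform (diag_of a) u <= qform (diag_of b) u.
Proof. by move=> ab; rewrite !qform_diag_of; apply: ler_sum. Qed.

Lemma qform_orthogonal G u : orthogonal_mx G -> qform 1%:M (G *m u) = qform 1%:M u.
Proof. by move=> Go; rewrite -qform_conj mulmx1 Go. Qed.

(** Weyl's monotonicity.  If b i < a i, the span of the first i + 1 eigenvectors of
    S and the span of the last n - i eigenvectors of T have a common nonzero vector
    for dimension reasons.  On it the form of S is at least a i and that of T at most
    b i, times the squared norm. *)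
Lemma eigenvalue_le S T a b : antitone a -> antitone b ->
  has_spectrum S a -> has_spectrum T b ->
  (forall x, qform S x <= qform T x) -> forall i, a i <= b i.
Proof.
move=> a_anti b_anti [G Go SE] [H Ho TE] ST i; rewrite leNgt; apply/negP => ba.
(* Rows spanning the two spaces of eigenvectors. *)
pose U : 'M[R]_n := pid_mx i.+1 *m G; pose W := copid_mx i *m H.
have rU : \rank U = i.+1.
  by rewrite mxrankMfree ?row_free_unit ?orthogonal_unitmx// rank_pid_mx.
have rW : \rank W = (n - i)%N.
  by rewrite mxrankMfree ?row_free_unit ?orthogonal_unitmx// rank_copid_mx// ltnW.
have : (U :&: W)%MS != 0.
  rewrite -mxrank_eq0 -lt0n -(ltn_add2l (\rank (U + W)%MS)) mxrank_sum_cap addn0.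
  rewrite rU rW (leq_ltn_trans (rank_leq_col _))// addSn subnKC ?ltnS// ltnW//.
move=> /rowV0Pn[v]; rewrite sub_capmx => /andP[/submxP[s vs] /submxP[t vt] v0].
have Gv (j : 'I_n) : (i < j)%N -> (G *m v^T) j 0 = 0.
  move=> ij; rewrite vs /U !trmx_mul !mulmxA orthogonal_mxC// mul1mx mxE big1// => k _.
  rewrite !mxE; case: eqP => [kj|_]; rewrite ?mul0r//.
  by rewrite kj ltnS leqNgt ij /= mul0r.
have Hv (j : 'I_n) : (j < i)%N -> (H *m v^T) j 0 = 0.
  move=> ij; rewrite vt /W !trmx_mul !mulmxA orthogonal_mxC// mul1mx mxE big1// => k _.
  rewrite !mxE -val_eqE /=; case: eqP => [->|_]; last by rewrite subr0 mul0r.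
  by rewrite ij subrr mul0r.
have v_gt0 : 0 < qform 1%:M v^T.
  have [_] := @posdef_diag_of R n (fun=> 1) (fun=> ltr01).
  by rewrite diag_of1; apply; rewrite trmx_eq0.
have : a i * qform 1%:M v^T <= b i * qform 1%:M v^T.
  have vE K : orthogonal_mx K -> qform 1%:M v^T = \sum_j (K *m v^T) j 0 ^+ 2.
    move=> Ko; rewrite -(qform_orthogonal v^T Ko) -diag_of1 qform_diag_of.
    by apply: eq_bigr => j _; rewrite mul1r.
  rewrite {1}(vE _ Go) (vE _ Ho) !mulr_sumr.
  have := ST v^T; rewrite SE TE !qform_conj !qform_diag_of => ab.
  apply: (le_trans _ (le_trans ab _)); apply: ler_sum => j _.
    have [ij|ji] := ltnP i j; first by rewrite Gv// expr0n !mulr0.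
    by rewrite ler_wpM2r ?sqr_ge0// a_anti.
  have [ij|ji] := ltnP j i; first by rewrite Hv// expr0n !mulr0.
  by rewrite ler_wpM2r ?sqr_ge0// b_anti.
by rewrite ler_pM2r// leNgt ba.
Qed.

(** The argument of Li and Mathias.  Raising to b k the eigenvalues of B below it
    gives a matrix B' with B <= B' and b k <= B'.  By monotonicity the eigenvalues of
    L^T B' L dominate both those of L^T B L and b k times those of L^T L.  The ratios
    of the former to the latter are therefore at least 1, so those with index
    in the image of the first k + 1 by p have a product at most that of all of them,
    which is a ratio of determinants. *)
Theorem lidskii_mul L B a b y (p : 'S_n) (k : 'I_n) : L \in unitmx ->
  antitone a -> antitone b -> antitone y -> (forall i, 0 < b i) ->
  has_spectrum (L^T *m L) a -> has_spectrum B b -> has_spectrum (L^T *m B *m L) y ->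
  \sum_(i < n | (i <= k)%N) (ln (y (p i)) - ln (a (p i))) <=
    \sum_(i < n | (i <= k)%N) ln (b i).
Proof.
move=> Lu a_anti b_anti y_anti b0 La [H Ho BE] LBy.
have a0 : forall i, 0 < a i.
  by apply/(posdef_spectrum La); exact: posdef_gram.
have y0 : forall i, 0 < y i.
  apply/(posdef_spectrum LBy); apply: posdef_conj => //.
  by apply/(@posdef_spectrum _ _ _ b) => //; exists H.
(* [B'] is [B] with its eigenvalues below [b k] raised to [b k]. *)
pose b' i := Num.max (b i) (b k).
have b'0 i : 0 < b' i by rewrite lt_max b0.
pose B' := H^T *m diag_of b' *m H.
have B'b' : has_spectrum B' b' by exists H.
have B'T : B'^T = B' by have [] := (posdef_spectrum B'b').2 b'0.
have [y' y'_anti LB'y'] := sym_spectrum (trmx_conj_sym L B'T).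
have yy' i : y i <= y' i.
  apply: (eigenvalue_le y_anti y'_anti LBy LB'y') => x; rewrite !qform_conj BE !qform_conj.
  by apply: qform_diag_of_le => j; rewrite ler_wpM2r ?sqr_ge0// le_max lexx.
have ay' i : b k * a i <= y' i.
  apply: (eigenvalue_le _ y'_anti (has_spectrumZ (b k) La) LB'y') => [j l jl|x].
    by rewrite ler_pM2l ?a_anti.
  have -> : b k *: (L^T *m L) = L^T *m (H^T *m diag_of (fun=> b k) *m H) *m L.
    have -> : diag_of (fun=> b k) = (b k)%:M :> 'M[R]_n.
      by rewrite -diag_const_mx; congr diag_mx; apply/rowP => j; rewrite !mxE.
    by rewrite mul_mx_scalar -scalemxAl Ho -scalemxAr mulmx1 scalemxAl.
  rewrite !qform_conj.
  by apply: qform_diag_of_le => j; rewrite ler_wpM2r ?sqr_ge0// le_max lexx orbT.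
have y'0 i : 0 < y' i by exact: lt_le_trans (yy' i).
(* The logarithms of the ratios. *)
pose r i := ln (y' i) - ln (b k) - ln (a i).
have r0 i : 0 <= r i.
  by rewrite /r -addrA -opprD subr_ge0 -lnM ?posrE// ler_ln ?posrE// mulr_gt0.
have r_sum : \sum_i r i = \sum_(i < n | (i <= k)%N) (ln (b i) - ln (b k)).
  have : \sum_i ln (y' i) = \sum_i ln (a i) + \sum_i ln (b' i).
    rewrite -!ln_prod// -lnM ?posrE ?prodr_gt0//.
    rewrite -(det_spectrum LB'y') -(det_spectrum La) -(det_spectrum B'b').
    by rewrite !det_mulmx mulrAC.
  move=> y'E; rewrite /r !sumrB y'E.
  rewrite (_ : _ - _ - _ = \sum_i ln (b' i) - \sum_(i < n) ln (b k)); last by ring.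
  rewrite -[RHS]sumrB [RHS]big_mkcond -[LHS]sumrB; apply: eq_bigr => i _.
  rewrite /b'; case: leqP => [ik|/ltnW ki].
    by rewrite (elimT max_idPl) ?b_anti.
  by rewrite (elimT max_idPr) ?b_anti// subrr.
apply: (@le_trans _ _ (\sum_(i < n | (i <= k)%N) (r (p i) + ln (b k)))).
  apply: ler_sum => i _; rewrite /r addrAC subrK lerB// ler_ln ?posrE//.
rewrite big_split /= -lerBrDr -sumrB -r_sum [leRHS](reindex_inj (@perm_inj _ p)) /=.
by rewrite [leRHS](bigID (fun i : 'I_n => (i <= k)%N)) /= lerDl sumr_ge0.
Qed.

End eigenvalue_inequalities.

(** * The optimal cost as a function of one eigenvalue *)

Section spectral_cost.

Variable R : realType.
Implicit Types (c y z : R).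

(** Abel summation: w is a nonnegative combination of indicators of initial
    segments. *)
Lemma sum_mul_antitone_le0 n (w d : 'I_n -> R) : antitone w -> (forall i, 0 <= w i) ->
  (forall k : 'I_n, \sum_(i < n | (i <= k)%N) d i <= 0) -> \sum_i w i * d i <= 0.
Proof.
elim: n w d => [|n IH] w d w_anti w0 d0; first by rewrite big_ord0.
have -> : \sum_i w i * d i =
    \sum_i (w i - w ord_max) * d i + w ord_max * \sum_i d i.
  by rewrite mulr_sumr -big_split /=; apply: eq_bigr => i _; ring.
rewrite -[leRHS]addr0 lerD //.
  rewrite big_ord_recr /= subrr mul0r addr0.
  apply: (IH (fun i => w (widen_ord (leqnSn n) i) - w ord_max)
             (fun i => d (widen_ord (leqnSn n) i))) => [i j ij|i|k].
  - by rewrite lerB// w_anti.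
  - by rewrite subr_ge0 w_anti// leq_ord.
  - apply: le_trans (d0 (widen_ord (leqnSn n) k)).
    by rewrite [leRHS]big_mkcond big_ord_recr -big_mkcond /= leqNgt ltn_ord addr0.
rewrite mulr_ge0_le0//; apply: le_trans (d0 ord_max).
by rewrite [leRHS]big_mkcond; apply: ler_sum => i _; rewrite leq_ord.
Qed.

(** This is ln r <= r - 1 at r = p / q. *)
Lemma ln_gibbs (p q : R) : 0 < p -> 0 <= q -> q * (ln p - ln q) <= p - q.
Proof.
move=> p0; rewrite le_eqVlt => /predU1P[<-|q0]; first by rewrite mul0r subr0 ltW.
rewrite -ln_div ?posrE// mulrC -ler_pdivlMr// mulrBl divff ?gt_eqF//.
rewrite -[p / q in leLHS](addrNK 1) addrC; apply: le_ln1Dx.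
by rewrite ltrBrDl subrr divr_gt0.
Qed.

Lemma antitone_perm n (f : 'I_n -> R) : exists p : 'S_n, antitone (f \o p).
Proof.
pose s := [tuple f i | i < n].
have /tuple_permP[p sE] : perm_eq (sort >=%R s) s by rewrite perm_sort.
exists p => i j ij; have := antitone_desc s ij.
by rewrite sE !nth_mktuple !tnth_mktuple.
Qed.

(** The positive root t of t + c^2 t^2 = y.  In the basis that diagonalizes both
    covariances, its inverse is a diagonal entry of the optimal precision matrix. *)
Definition tau c y : R := (Num.sqrt (1 + 4 * c ^+ 2 * y) - 1) / (2 * c ^+ 2).

(** Contribution to the optimal cost, divided by 2 lambda, of an eigenvalue y of
    S1 S2, for c = 1 / (2 lambda). *)
Definition spectral_cost c y : R := - (ln (tau c y) + 2 * c ^+ 2 * tau c y).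

Lemma tauE c y : 0 < c -> 0 < y -> tau c y + c ^+ 2 * tau c y ^+ 2 = y.
Proof.
move=> c0 y0; rewrite /tau; set s := Num.sqrt _.
have sE : s ^+ 2 = 1 + 4 * c ^+ 2 * y.
  by rewrite sqr_sqrtr// addr_ge0// mulr_ge0 ?ltW// mulr_gt0// exprn_gt0.
have -> : y = (s ^+ 2 - 1) / (4 * c ^+ 2) by rewrite sE; field; rewrite gt_eqF.
by field; rewrite gt_eqF.
Qed.

Lemma tau_gt0 c y : 0 < c -> 0 < y -> 0 < tau c y.
Proof.
move=> c0 y0; have c2 : 0 < c ^+ 2 by rewrite exprn_gt0.
rewrite divr_gt0 ?mulr_gt0// subr_gt0 -[ltLHS]sqrtr1 ltr_sqrt ?ltrDl ?mulr_gt0//.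
by rewrite addr_gt0// !mulr_gt0.
Qed.

Lemma tau_le c y z : 0 < c -> y <= z -> tau c y <= tau c z.
Proof.
move=> c0 yz; have c2 : 0 < c ^+ 2 by rewrite exprn_gt0.
rewrite ler_pM2r ?invr_gt0 ?mulr_gt0// lerB// ler_wsqrtr// lerD2l ler_pM2l// mulr_gt0//.
Qed.

(** As a function of ln y the cost is concave and has slope - (1 + c^2 tau c y).  With
    y = t + c^2 t^2 and z = s + c^2 s^2 the tangent inequality is c^2 times
    [ln_gibbs] at t, s plus [ln_gibbs] at 1 + c^2 t, 1 + c^2 s. *)
Lemma spectral_cost_tangent c y z : 0 < c -> 0 < y -> 0 < z ->
  spectral_cost c y <=
    spectral_cost c z + (1 + c ^+ 2 * tau c z) * (ln z - ln y).
Proof.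
move=> c0 y0 z0; have c2 : 0 < c ^+ 2 by rewrite exprn_gt0.
have := tauE c0 y0; have := tauE c0 z0; rewrite /spectral_cost.
have := tau_gt0 c0 y0; have := tau_gt0 c0 z0.
move: (tau c y) (tau c z) (c ^+ 2) c2 => t s k k0 s0 t0 <- <-.
have lnE (r : R) : 0 < r -> ln (r + k * r ^+ 2) = ln r + ln (1 + k * r).
  move=> r0; have kr : 0 < 1 + k * r by rewrite addr_gt0// mulr_gt0.
  by rewrite -lnM ?posrE//; congr ln; ring.
rewrite !lnE//.
have ks : 0 <= 1 + k * s by rewrite addr_ge0// mulr_ge0// ltW.
have kt : 0 < 1 + k * t by rewrite addr_gt0// mulr_gt0.
have := ln_gibbs kt ks; have := ler_wpM2l (ltW k0) (ln_gibbs t0 (ltW s0)).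
move: (ln t) (ln s) (ln (1 + k * t)) (ln (1 + k * s)) => lt ls lkt lks.
by lra.
Qed.

(** Karamata's inequality: the slopes of the tangents at z are monotone, as Abel
    summation needs. *)
Lemma sum_spectral_cost_le c n (y z : 'I_n -> R) : 0 < c ->
  (forall i, 0 < y i) -> (forall i, 0 < z i) -> antitone z ->
  (forall k : 'I_n, \sum_(i < n | (i <= k)%N) (ln (z i) - ln (y i)) <= 0) ->
  \sum_i spectral_cost c (y i) <= \sum_i spectral_cost c (z i).
Proof.
move=> c0 y0 z0 z_anti zy.
apply: (@le_trans _ _ (\sum_i (spectral_cost c (z i) +
    (1 + c ^+ 2 * tau c (z i)) * (ln (z i) - ln (y i))))).
  by apply: ler_sum => i _; exact: spectral_cost_tangent.
rewrite big_split /= gerDl; apply: sum_mul_antitone_le0 => //.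
  by move=> i j ij; rewrite lerD2l ler_pM2l ?exprn_gt0// tau_le// z_anti.
by move=> i; rewrite addr_ge0// mulr_ge0 ?sqr_ge0// ltW// tau_gt0.
Qed.

End spectral_cost.

(** * Functions with a finite integral *)

Definition has_integral d (T : measurableType d) (R : realType)
    (mu : set T -> \bar R) (f : T -> R) (v : R) : Prop :=
  mu.-integrable setT (EFin \o f) /\ (\int[mu]_x (f x)%:E = v%:E)%E.

Section has_integral_theory.

Context d (T : measurableType d) (R : realType) (mu : {measure set T -> \bar R}).
Implicit Types (f g : T -> R) (u v k : R).

Lemma has_integralD f g u v : has_integral mu f u -> has_integral mu g v ->
  has_integral mu (fun x => f x + g x) (u + v).
Proof.
move=> [fi fu] [gi gv]; split; first exact: (integrableD measurableT fi gi).
by rewrite (integralD_EFin measurableT fi gi) fu gv.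
Qed.

Lemma has_integralZ k f u : has_integral mu f u ->
  has_integral mu (fun x => k * f x) (k * u).
Proof.
move=> [fi fu]; split; first exact: (integrableZl measurableT k fi).
under eq_integral do rewrite EFinM.
by rewrite (integralZl measurableT fi) fu.
Qed.

Lemma has_integralB f g u v : has_integral mu f u -> has_integral mu g v ->
  has_integral mu (fun x => f x - g x) (u - v).
Proof.
move=> fu /(has_integralZ (-1)) gv; have := has_integralD fu gv.
rewrite mulN1r; congr has_integral; by apply/funext => x; rewrite mulN1r.
Qed.

Lemma has_integral_le f g u v : has_integral mu f u -> has_integral mu g v ->
  (forall x, f x <= g x) -> u <= v.
Proof.
move=> [fi fu] [gi gv] fg; rewrite -lee_fin -fu -gv.
by apply: le_integral => // x _; rewrite lee_fin.
Qed.

Lemma has_integral_ext f g u v : has_integral mu f u -> f =1 g -> u = v ->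
  has_integral mu g v.
Proof. by move=> fu fg <-; rewrite (_ : g = f)//; apply/funext => x; rewrite fg. Qed.

Lemma has_integral_ge0 f u : measurable_fun setT f -> (forall x, 0 <= f x) ->
  (\int[mu]_x (f x)%:E = u%:E)%E -> has_integral mu f u.
Proof.
move=> mf f0 fu; split=> //; apply/integrableP; split; first exact/measurable_EFinP.
by under eq_integral do rewrite /= ger0_norm//; rewrite fu ltry.
Qed.

Lemma has_integral_dominated f g u : measurable_fun setT f ->
  has_integral mu g u -> (forall x, `|f x| <= g x) ->
  exists v, has_integral mu f v.
Proof.
move=> mf [gi _] fg.
have fi : mu.-integrable setT (EFin \o f).
  apply: (le_integrable measurableT _ _ gi); first exact/measurable_EFinP.
  by move=> x _ /=; rewrite lee_fin (le_trans (fg x))// ler_norm.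
exists (fine (\int[mu]_x (f x)%:E)%E); split => //.
by rewrite fineK// integrable_fin_num.
Qed.

End has_integral_theory.

(** * Moments of the normal distribution on the line *)

Section normal_moments.

Variable R : realType.
Local Notation mu := (@lebesgue_measure R).
Implicit Types (m v t h : R).

Definition gauss1 m v (t : R) : R :=
  (Num.sqrt (2 * pi * v))^-1 * expR (- ((t - m) ^+ 2 / (2 * v))).

Lemma gauss1_ge0 m v t : 0 <= gauss1 m v t.
Proof. by rewrite mulr_ge0 ?invr_ge0 ?sqrtr_ge0 ?expR_ge0. Qed.

Lemma gauss1E m v : 0 < v -> gauss1 m v = normal_pdf m (Num.sqrt v).
Proof.
move=> v0; rewrite normal_pdfE ?gt_eqF ?sqrtr_gt0//; apply/funext => t.
rewrite /normal_peak /normal_fun sqr_sqrtr ?ltW//.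
have -> : v * pi *+ 2 = 2 * pi * v by ring.
have -> : v *+ 2 = 2 * v by ring.
by rewrite mulNr.
Qed.

Lemma measurable_gauss1 m v : 0 < v ->
  measurable_fun [set: measurableTypeR R] (gauss1 m v).
Proof. by move=> v0; rewrite gauss1E//; exact: measurable_normal_pdf. Qed.

Lemma gauss1_mass m v : 0 < v -> has_integral mu (gauss1 m v) 1.
Proof.
move=> v0; apply: has_integral_ge0; [exact: measurable_gauss1|exact: gauss1_ge0|].
by rewrite gauss1E// integral_normal_pdf.
Qed.

Lemma measurable_center m :
  measurable_fun [set: measurableTypeR R] (fun t : R => t - m).
Proof. by apply: measurable_funB => //; exact: measurable_id. Qed.

(** The bound u exp (- u) <= 2 exp (- u / 2) compares the integrand with a normal
    density of variance 2 v. *)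
Lemma gauss1_second_moment_exists m v : 0 < v ->
  exists J, has_integral mu (fun t : R => (t - m) ^+ 2 * gauss1 m v t) J.
Proof.
move=> v0; have v20 : 0 < 2 * v by rewrite mulr_gt0.
have hg := has_integralZ (4 * v * Num.sqrt 2) (gauss1_mass m v20).
apply: (has_integral_dominated _ hg) => [|t].
  apply: measurable_funM; last exact: measurable_gauss1.
  by apply: measurable_funX; exact: measurable_center.
rewrite ger0_norm; last by rewrite mulr_ge0 ?sqr_ge0 ?gauss1_ge0.
rewrite /gauss1.
have -> : Num.sqrt (2 * pi * (2 * v)) = Num.sqrt 2 * Num.sqrt (2 * pi * v).
  by rewrite -sqrtrM//; congr Num.sqrt; ring.
set s := Num.sqrt (2 * pi * v); set r := (t - m) ^+ 2.
have s0 : 0 < s by rewrite sqrtr_gt0 !mulr_gt0 ?pi_gt0.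
have r2 : 0 < Num.sqrt (2 : R) by rewrite sqrtr_gt0.
rewrite (_ : 4 * v * _ * _ = s^-1 * (4 * v * expR (- (r / (2 * (2 * v)))))); last first.
  by field; rewrite !gt_eqF.
rewrite mulrCA ler_pM2l ?invr_gt0//.
set w := r / (2 * (2 * v)).
have -> : r / (2 * v) = w + w by rewrite /w; field; rewrite gt_eqF.
have -> : r = 4 * v * w by rewrite /w; field; rewrite gt_eqF.
rewrite opprD expRD [leLHS](_ : _ = 4 * v * expR (- w) * (w * expR (- w))); last by ring.
rewrite ger_pMr ?mulr_gt0 ?expR_gt0//.
rewrite expRN -ler_pdivlMr ?invr_gt0 ?expR_gt0// div1r invrK.
by apply: le_trans (expR_ge1Dx _); rewrite lerDr.
Qed.

(** The density of mean m + h is the density of mean m times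
    exp (h (t - m) / v - h^2 / (2 v)).  Bounding this exponential below by its
    tangent and integrating gives 2 h J <= h^2 for all h, hence J = 0. *)
Lemma gauss1_first_moment m v : 0 < v ->
  has_integral mu (fun t : R => (t - m) * gauss1 m v t) 0.
Proof.
move=> v0; have [J2 hJ2] := gauss1_second_moment_exists m v0.
have [J hJ] : exists J, has_integral mu (fun t : R => (t - m) * gauss1 m v t) J.
  apply: (has_integral_dominated _ (has_integralD (gauss1_mass m v0) hJ2)) => [|t].
    by apply: measurable_funM; [exact: measurable_center|exact: measurable_gauss1].
  rewrite normrM (ger0_norm (gauss1_ge0 _ _ _)).
  rewrite -[X in _ <= X + _]mul1r -mulrDl ler_wpM2r ?gauss1_ge0//.
  rewrite -[X in 1 + X]real_normK ?num_real// -subr_ge0.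
  rewrite (_ : _ - _ = (`|t - m| - 1 / 2) ^+ 2 + 3 / 4); last by field.
  by rewrite addr_ge0 ?sqr_ge0.
suff J0 : J = 0 by rewrite -J0 in hJ *.
have tangent h : 2 * h * J <= h ^+ 2.
  suff : (1 - h ^+ 2 / (2 * v)) * 1 + h / v * J <= 1.
    rewrite -subr_ge0 (_ : 1 - (_ * 1 + _) = (h ^+ 2 - 2 * h * J) / (2 * v)).
      by rewrite pmulr_lge0 ?invr_gt0 ?mulr_gt0// subr_ge0.
    by field; rewrite gt_eqF.
  apply: (has_integral_le (has_integralD (has_integralZ (1 - h ^+ 2 / (2 * v))
    (gauss1_mass m v0)) (has_integralZ (h / v) hJ)) (gauss1_mass (m + h) v0)) => t.
  rewrite /gauss1; set s := (Num.sqrt _)^-1.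
  have s0 : 0 <= s by rewrite invr_ge0 sqrtr_ge0.
  set e := (t - m) ^+ 2 / (2 * v).
  have -> : - ((t - (m + h)) ^+ 2 / (2 * v)) = - e + (h / v * (t - m) - h ^+ 2 / (2 * v)).
    by rewrite /e; field; rewrite gt_eqF.
  rewrite expRD; set q := h / v * (t - m) - h ^+ 2 / (2 * v).
  rewrite [leLHS](_ : _ = s * (expR (- e) * (1 + q))); last by rewrite /q; ring.
  by rewrite ler_wpM2l// ler_wpM2l ?expR_ge0// expR_ge1Dx.
have := tangent J; rewrite expr2 => JJ; apply/eqP; rewrite -sqrf_eq0 expr2.
rewrite eq_le -{2}expr2 sqr_ge0 andbT; clear -JJ; lra.
Qed.

(** The same device, applied to the densities of variance r^2 v, gives
    (r - 1) (r^2 - j (r + 1)) >= 0 for all r > 0, where 2 v j is the second moment.  So the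
    second factor vanishes at r = 1, that is, j = 1 / 2. *)
Lemma gauss1_second_moment m v : 0 < v ->
  has_integral mu (fun t : R => (t - m) ^+ 2 * gauss1 m v t) v.
Proof.
move=> v0; have [J hJ] := gauss1_second_moment_exists m v0.
have J0 : 0 <= J.
  have [_ JE] := hJ; rewrite -lee_fin -JE; apply: integral_ge0 => t _.
  by rewrite lee_fin mulr_ge0 ?sqr_ge0 ?gauss1_ge0.
pose j := J / (2 * v).
have j0 : 0 <= j by rewrite divr_ge0// mulr_ge0// ltW.
suff jE : j = 1 / 2.
  suff vJ : J = v by rewrite -{2}vJ.
  have := jE; rewrite /j => /(canRL (divfK _)) ->; last by rewrite gt_eqF ?mulr_gt0.
  by field.
have tangent r : 0 < r -> 0 <= (r - 1) * (r ^+ 2 - j * (r + 1)).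
  move=> r0; have vr : 0 < v * r ^+ 2 by rewrite mulr_gt0// exprn_gt0.
  suff : 1 - (1 / r ^+ 2 - 1) / (2 * v) * J <= r * 1.
    rewrite -subr_ge0 (_ : r * 1 - _ = (r - 1) * (r ^+ 2 - j * (r + 1)) / r ^+ 2).
      by rewrite pmulr_lge0 ?invr_gt0 ?exprn_gt0.
    by rewrite /j; field; rewrite !gt_eqF.
  apply: (has_integral_le (has_integralB (gauss1_mass m v0)
    (has_integralZ ((1 / r ^+ 2 - 1) / (2 * v)) hJ))
    (has_integralZ r (gauss1_mass m vr))) => t.
  rewrite /gauss1.
  have -> : Num.sqrt (2 * pi * (v * r ^+ 2)) = Num.sqrt (2 * pi * v) * r.
    rewrite mulrA sqrtrM ?mulr_ge0 ?pi_ge0// ?ltW//.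
    by rewrite sqrtr_sqr gtr0_norm.
  set s := Num.sqrt _.
  have s0 : 0 < s by rewrite sqrtr_gt0 !mulr_gt0// pi_gt0.
  set e := (t - m) ^+ 2.
  have -> : - (e / (2 * (v * r ^+ 2))) = - (e / (2 * v)) + (1 - 1 / r ^+ 2) * e / (2 * v).
    by field; rewrite !gt_eqF.
  rewrite expRD; set q := (1 - 1 / r ^+ 2) * e / (2 * v).
  rewrite [leLHS](_ : _ = s^-1 * (expR (- (e / (2 * v))) * (1 + q))); last first.
    by rewrite /q; field; rewrite !gt_eqF.
  rewrite [leRHS](_ : _ = s^-1 * (expR (- (e / (2 * v))) * expR q)); last first.
    by field; rewrite !gt_eqF.
  by rewrite ler_wpM2l ?invr_ge0 ?(ltW s0)// ler_wpM2l ?expR_ge0// expR_ge1Dx.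
apply/eqP; rewrite eq_le; apply/andP; split; rewrite leNgt; apply/negP => jlt.
  (* [(1 + e) ^+ 2 - j * (2 + e)] is at most [1 - 2 * j + 3 * e], still negative. *)
  pose e := Num.min 1 ((2 * j - 1) / 4).
  have e0 : 0 < e by rewrite lt_min ltr01 /= divr_gt0//; lra.
  have e1 : e <= 1 by rewrite ge_min lexx.
  have e2 : e <= (2 * j - 1) / 4 by rewrite ge_min lexx orbT.
  have := tangent (1 + e); rewrite addrAC subrr add0r pmulr_rge0// addr_gt0// => /(_ isT).
  have ee : e * e <= e by rewrite ger_pMr.
  have je : 0 <= j * e by rewrite mulr_ge0// ltW.
  rewrite expr2; clear -ee je e2 jlt; lra.
(* [(1 - e) ^+ 2 - j * (2 - e)] is at least [1 - 2 * j - 2 * e], still positive. *)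
pose e := (1 - 2 * j) / 4.
have e0 : 0 < e by rewrite /e; lra.
have e1 : 4 * e = 1 - 2 * j by rewrite /e; field.
have := tangent (1 - e) => /(_ _); rewrite (_ : 1 - e - 1 = - e); last by ring.
rewrite mulNr oppr_ge0 pmulr_rle0// => H.
have : 0 < 1 - e by lra.
have ee : 0 <= e * e by rewrite -expr2 sqr_ge0.
have je : 0 <= j * e by rewrite mulr_ge0// ltW.
move=> /H; rewrite expr2; clear -ee je e0 e1; lra.
Qed.

Lemma gauss1_quadratic m v (al be ga : R) : 0 < v ->
  has_integral mu (fun t : R => (al * (t - m) ^+ 2 + be * (t - m) + ga) * gauss1 m v t)
    (al * v + ga).
Proof.
move=> v0.
have h2 := has_integralZ al (gauss1_second_moment m v0).
have h1 := has_integralZ be (gauss1_first_moment m v0).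
have h0 := has_integralZ ga (gauss1_mass m v0).
apply: has_integral_ext (has_integralD (has_integralD h2 h1) h0) _ _ => [t|]; ring.
Qed.

End normal_moments.

(** * Gaussian integrals of quadratic polynomials *)

Definition col_of_pt (R : realType) n (x : rvec R n) : 'cV[R]_n := \col_i tnth x i.

Definition quadratic (R : realType) n (Q : 'M[R]_n) (l : 'rV[R]_n) (k : R)
    (u : 'cV[R]_n) : R :=
  qform Q u + (l *m u) 0 0 + k.

Section gauss_moments.

Variable R : realType.

Lemma gauss_pdfE n m (S : 'M[R]_n) x : gauss_pdf m S x =
  (Num.sqrt ((2 * pi) ^+ n * \det S))^-1 * expR (- (qform (invmx S) (col_of_pt x - m) / 2)).
Proof. by []. Qed.

Section conditioning.

Variables (n : nat) (v : R) (w : 'cV[R]_n) (S' : 'M[R]_n).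
Hypotheses (v0 : 0 < v) (S'pos : posdefmx S').

(** Covariance of a centered pair (t, u) where u has covariance S' and t, given u, has
    mean w^T u and variance v. *)
Definition cond_block : 'M[R]_(1 + n) :=
  block_mx (v%:M + w^T *m S' *m w) (w^T *m S') (S' *m w) S'.

Let T : 'M[R]_(1 + n) := block_mx 1%:M w^T 0 1%:M.

Let U : 'M[R]_(1 + n) := block_mx 1%:M (- w^T) 0 1%:M.

Let cond_blockE : cond_block = T *m block_mx v%:M 0 0 S' *m T^T.
Proof.
rewrite /T tr_block_mx !mulmx_block trmxK !trmx1 !trmx0.
by rewrite !(mul0mx,mulmx0,addr0,add0r,mulmx1,mul1mx).
Qed.

Lemma det_cond_block : \det cond_block = v * \det S'.
Proof.
rewrite cond_blockE !det_mulmx det_tr /T !det_ublock !det1 det_scalar1; ring.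
Qed.

(** The block matrix is T diag (v, S') T^T with T unipotent. *)
Lemma qform_inv_cond_block t (u : 'cV[R]_n) :
  qform (invmx cond_block) (col_mx t%:M u) =
    (t - (w^T *m u) 0 0) ^+ 2 / v + qform (invmx S') u.
Proof.
have TU : T *m U = 1%:M.
  rewrite /T /U mulmx_block !(mul0mx,mulmx0,addr0,add0r,mulmx1,mul1mx).
  by rewrite addrC subrr -scalar_mx_block.
have UT : U *m T = 1%:M by exact: mulmx1C.
have -> : invmx cond_block = U^T *m block_mx (v^-1)%:M 0 0 (invmx S') *m U.
  apply: invmx_eq; rewrite cond_blockE !mulmxA -(mulmxA _ T^T) -trmx_mul UT trmx1 mulmx1.
  rewrite -(mulmxA T) mulmx_block !(mul0mx,mulmx0,addr0,add0r) mulmxV ?posdef_unitmx//.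
  by rewrite -scalar_mxM mulfV ?gt_eqF// -scalar_mx_block mulmx1.
rewrite qform_conj /U mul_block_col !(mul0mx,mul1mx,add0r) mulNmx.
set z := w^T *m u; have -> : t%:M - z = (t - z 0 0)%:M.
  by rewrite [z in LHS]mx11_scalar -raddfB.
rewrite /qform tr_col_mx mul_row_block !(mul0mx,mulmx0,addr0,add0r) mul_row_col mxE.
congr (_ + _); rewrite tr_scalar_mx -!scalar_mxM mxE eqxx mulr1n; ring.
Qed.

(** The density of the first coordinate given the others, times the density of
    the others. *)
Lemma gauss_pdf_cons m0 (m : 'cV[R]_n) t (x : rvec R n) :
  gauss_pdf (col_mx m0%:M m : 'cV[R]_n.+1) (cond_block : 'M[R]_n.+1) (cons_pt (t, x)) =
  gauss1 (m0 + (w^T *m (col_of_pt x - m)) 0 0) v t * gauss_pdf m S' x.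
Proof.
rewrite !gauss_pdfE /gauss1.
have -> : col_of_pt (cons_pt (t, x)) - (col_mx m0%:M m : 'cV[R]_n.+1) =
    col_mx (t - m0)%:M (col_of_pt x - m).
  apply/colP => i; rewrite !mxE; case: splitP => j ij; rewrite !mxE.
    rewrite ord1 in ij; have -> : i = ord0 by exact: val_inj.
    by rewrite ord1 eqxx.
  have -> : i = lift ord0 j by exact: val_inj.
  by rewrite tnthS.
have -> : \det (cond_block : 'M[R]_n.+1) = v * \det S' by exact: det_cond_block.
rewrite qform_inv_cond_block opprD addrA.
set a := t - m0 - _; set b := qform _ _.
have -> : - ((a ^+ 2 / v + b) / 2) = - (a ^+ 2 / (2 * v)) - b / 2.
  by field; rewrite gt_eqF.
have -> : (2 * pi) ^+ n.+1 * (v * \det S') = (2 * pi * v) * ((2 * pi) ^+ n * \det S').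
  by rewrite exprS; ring.
by rewrite sqrtrM ?mulr_ge0 ?pi_ge0 ?(ltW v0)// invfM expRD mulrACA.
Qed.

End conditioning.

(** The variance v is the Schur complement of S' in S; it is positive, being the
    value of the form at (1, - w). *)
Lemma posdef_cond_block n (S : 'M[R]_(1 + n)) : posdefmx S ->
  exists v w S', [/\ 0 < v, posdefmx S' & S = cond_block v w S'].
Proof.
move=> [ST Sp]; pose S' := drsubmx S.
have S'pos : posdefmx S'.
  split=> [|x x0]; first by rewrite trmx_drsub ST.
  have := Sp (col_mx 0 x); rewrite -{1}[S]submxK tr_col_mx mul_row_block mul_row_col.
  rewrite !trmx0 !(mul0mx,mulmx0,addr0,add0r); apply.
  by apply: contra x0 => /eqP x0; rewrite -(col_mxKd (0 : 'cV_1) x) x0 linear0.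
have S'u := posdef_unitmx S'pos.
pose w := invmx S' *m dlsubmx S; pose v := (ulsubmx S - w^T *m S' *m w) 0 0.
have SE : S = cond_block v w S'.
  rewrite -[LHS]submxK /cond_block; congr block_mx.
  - by rewrite -mx11_scalar subrK.
  - by rewrite /w trmx_mul trmx_inv S'pos.1 mulmxKV// trmx_dlsub ST.
  - by rewrite mulKVmx.
clearbody v; clearbody w; exists v, w, S'; split=> //.
have := Sp (col_mx 1%:M (- w)); rewrite SE tr_col_mx mul_row_block mul_row_col.
rewrite trmx1 !mul1mx linearN /= !mulNmx !mulmxN mulmxA addrK subrr mul0mx subr0.
rewrite mulmx1 mxE eqxx; apply.
apply/eqP => /colP /(_ (lshift n 0)); rewrite col_mxEu !mxE eqxx => /eqP.
by rewrite oner_eq0.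
Qed.

Lemma measurable_qform n (Q : 'M[R]_n) m :
  measurable_fun [set: rvec R n] (fun x => qform Q (col_of_pt x - m)).
Proof.
have mv i : measurable_fun [set: rvec R n] (fun x : rvec R n => tnth x i - m i 0).
  by apply: measurable_funB => //; exact: measurable_tnth.
pose q (x : rvec R n) :=
  \sum_j (\sum_k (tnth x k - m k 0) * Q k j) * (tnth x j - m j 0).
suff mq : measurable_fun setT q.
  apply: eq_measurable_fun mq => x _; rewrite /q /qform mxE; apply: eq_bigr => j _.
  by rewrite !mxE; congr (_ * _); apply: eq_bigr => k _; rewrite !mxE.
apply: measurable_sum => j; apply: measurable_funM => //.
by apply: measurable_sum => k; exact: measurable_funM.
Qed.

Lemma measurable_quadratic n (Q : 'M[R]_n) l k m :
  measurable_fun [set: rvec R n] (fun x => quadratic Q l k (col_of_pt x - m)).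
Proof.
apply: measurable_funD => //; apply: measurable_funD; first exact: measurable_qform.
pose q (x : rvec R n) := \sum_j l 0 j * (tnth x j - m j 0).
suff mq : measurable_fun setT q.
  by apply: eq_measurable_fun mq => x _; rewrite mxE; apply: eq_bigr => j _; rewrite !mxE.
apply: measurable_sum => j; apply: measurable_funM => //.
by apply: measurable_funB => //; exact: measurable_tnth.
Qed.

Lemma ge0_integral_rvecS n (F : rvec R n.+1 -> \bar R) :
  measurable_fun setT F -> (forall x, (0 <= F x)%E) ->
  (\int[@lebesgue_rvec R n.+1]_x F x =
   \int[@lebesgue_rvec R n]_x \int[@lebesgue_measure R]_t F (cons_pt (t, x)))%E.
Proof.
move=> mF F0.
have mG : measurable_fun setT (F \o @cons_pt R n).
  by apply: (measurableT_comp mF); exact: measurable_cons_pt.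
have := @fubini_tonelli2 _ _ _ _ R (@lebesgue_measure R) (@lebesgue_rvec R n) _ mG.
rewrite /fubini_G /= => <- //.
rewrite (ge0_integral_pushforward (@measurable_cons_pt R n)) ?preimage_setT//.
Qed.

End gauss_moments.

Section gauss_nonnegative_quadratic.

Variable R : realType.

(** The law of total variance for a quadratic form. *)
Lemma mxtrace_cond_block n v w (S' : 'M[R]_n) (Q : 'M[R]_(1 + n)) :
  \tr (Q *m cond_block v w S') =
  \tr ((col_mx w^T 1%:M)^T *m Q *m col_mx w^T 1%:M *m S') + v * qform Q (col_mx 1%:M 0).
Proof.
have -> : cond_block v w S' = col_mx w^T 1%:M *m S' *m (col_mx w^T 1%:M)^T +
    v *: (col_mx 1%:M 0 *m (col_mx 1%:M 0)^T).
  rewrite mul_col_mx mul1mx !tr_col_mx !mul_col_row trmx1 trmx0 trmxK.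
  rewrite !(mul0mx,mulmx0,mulmx1) scale_block_mx !scaler0 scalemx1 add_block_mx !addr0.
  by rewrite /cond_block addrC !trmx1 !mulmx1.
rewrite mulmxDr linearD /=; congr (_ + _).
  by rewrite mulmxA mxtrace_mulC !mulmxA.
rewrite -scalemxAr mxtraceZ; congr (_ * _).
by rewrite mulmxA mxtrace_mulC /qform mulmxA /mxtrace big_ord1.
Qed.

(** Expansion in the deviation s of the first coordinate from its mean given the
    others. *)
Lemma quadratic_cons n (Q : 'M[R]_(1 + n)) l k (w : 'cV[R]_n) (s : R) u :
  let e : 'cV[R]_(1 + n) := col_mx 1%:M 0 in
  let E := col_mx w^T 1%:M in
  quadratic Q l k (col_mx (s + (w^T *m u) 0 0)%:M u) =
  qform Q e * s ^+ 2 +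
    ((e^T *m Q *m (E *m u)) 0 0 + ((E *m u)^T *m Q *m e) 0 0 + (l *m e) 0 0) * s +
    quadratic (E^T *m Q *m E) (l *m E) k u.
Proof.
move=> e E.
have -> : col_mx (s + (w^T *m u) 0 0)%:M u = s *: e + E *m u.
  rewrite scale_col_mx scaler0 mul_col_mx add_col_mx mul1mx add0r; congr col_mx.
  by rewrite raddfD /= -mx11_scalar scalemx1.
rewrite /quadratic qformD qformZ qform_conj mulmxDr -scalemxAr !mulmxA.
have addE (A B : 'M[R]_1) : (A + B) 0 0 = A 0 0 + B 0 0 by rewrite mxE.
have scaleE a (A : 'M[R]_1) : (a *: A) 0 0 = a * A 0 0 by rewrite mxE.
rewrite [(s *: e)^T]linearZ /= -!scalemxAr -!scalemxAl !addE !scaleE; ring.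
Qed.

(** Given the other coordinates, the first one is normal, so integrating it out
    leaves a quadratic polynomial in the others.  It is again nonnegative, so
    Tonelli's theorem applies at every stage of the induction. *)
Theorem gauss_ge0_quadratic n (m : 'cV[R]_n) S Q l k : posdefmx S ->
  (forall u, 0 <= quadratic Q l k u) ->
  (\int[@lebesgue_rvec R n]_x (quadratic Q l k (col_of_pt x - m) * gauss_pdf m S x)%:E
     = (\tr (Q *m S) + k)%:E)%E.
Proof.
elim: n m S Q l k => [|n IH] m S Q l k S_pos q0.
  rewrite /= integral_dirac//; last first.
    apply/measurable_EFinP/measurable_funM; first exact: measurable_quadratic.
    exact: measurable_gauss_pdf.
  rewrite diracT mul1e gauss_pdfE expr0 mul1r det_mx00 sqrtr1 invr1 mul1r.
  rewrite (flatmx0 (_ - m)) /quadratic !qform0 mul0r oppr0 expR0 mulr1 mulmx0 mxE.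
  by rewrite addr0 add0r /mxtrace big_ord0 add0r.
have [v [w [S' [v0 S'pos SE]]]] := @posdef_cond_block R n S S_pos.
pose m0 : R := m ord0 0; pose m' : 'cV[R]_n := \col_i m (lift ord0 i) 0.
have mE : m = (col_mx m0%:M m' : 'cV[R]_n.+1).
  apply/colP => i; rewrite [RHS]mxE; case: splitP => j ij; rewrite !mxE.
    rewrite ord1 in ij; have -> : i = ord0 by exact: val_inj.
    by rewrite ord1 eqxx.
  by have -> : i = lift ord0 j by exact: val_inj.
have mF : measurable_fun [set: rvec R n.+1]
    (fun x => quadratic Q l k (col_of_pt x - m) * gauss_pdf m S x).
  by apply: measurable_funM; [exact: measurable_quadratic|exact: measurable_gauss_pdf].
rewrite ge0_integral_rvecS; [|exact/measurable_EFinP|]; last first.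
  by move=> x; rewrite lee_fin mulr_ge0// gauss_pdf_ge0.
pose e : 'cV[R]_(1 + n) := col_mx 1%:M 0.
pose E : 'M[R]_(1 + n, n) := col_mx w^T 1%:M.
pose k' := k + v * qform Q e.
have inner x : (\int[lebesgue_measure]_t (quadratic Q l k (col_of_pt (cons_pt (t, x)) - m) *
    gauss_pdf m S (cons_pt (t, x)))%:E =
    (quadratic (E^T *m Q *m E) (l *m E) k' (col_of_pt x - m') * gauss_pdf m' S' x)%:E)%E.
  set u := col_of_pt x - m'; pose mu := m0 + (w^T *m u) 0 0.
  pose be := (e^T *m Q *m (E *m u)) 0 0 + ((E *m u)^T *m Q *m e) 0 0 + (l *m e) 0 0.
  have [_] := has_integralZ (gauss_pdf m' S' x)
    (gauss1_quadratic mu (qform Q e) be (quadratic (E^T *m Q *m E) (l *m E) k u) v0).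
  rewrite (_ : _ * (_ + _) = quadratic (E^T *m Q *m E) (l *m E) k' u * gauss_pdf m' S' x).
    move=> <-; apply: eq_integral => t _; congr EFin.
    have -> : col_of_pt (cons_pt (t, x)) - m = col_mx ((t - mu) + (w^T *m u) 0 0)%:M u.
      rewrite /mu opprD addrA subrK mE.
      apply/colP => i; rewrite [in LHS]mxE [RHS]mxE [X in _ + X = _]mxE [X in _ - X]mxE.
      case: splitP => j ij.
        rewrite ord1 in ij; have -> : i = ord0 by exact: val_inj.
        by rewrite !mxE ord1 eqxx.
      have -> : i = lift ord0 j by exact: val_inj.
      by rewrite !mxE tnthS.
    rewrite quadratic_cons {1}SE mE gauss_pdf_cons// -/u -/mu -/e -/E -/be; ring.
  by rewrite /quadratic /k'; ring.
under eq_integral do rewrite inner.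
rewrite IH// => [|u].
  by rewrite SE mxtrace_cond_block /k'; congr EFin; ring.
have h := gauss1_quadratic 0 (qform Q e) ((e^T *m Q *m (E *m u)) 0 0 +
  ((E *m u)^T *m Q *m e) 0 0 + (l *m e) 0 0) (quadratic (E^T *m Q *m E) (l *m E) k u) v0.
have [_ hE] := h.
have -> : quadratic (E^T *m Q *m E) (l *m E) k' u =
    qform Q e * v + quadratic (E^T *m Q *m E) (l *m E) k u.
  by rewrite /quadratic /k'; ring.
rewrite -lee_fin -hE; apply: integral_ge0 => t _; rewrite lee_fin mulr_ge0 ?gauss1_ge0//.
by rewrite subr0 -quadratic_cons.
Qed.

End gauss_nonnegative_quadratic.

Section gauss_integrals.

Variable R : realType.

(** Every quadratic polynomial is the difference of two nonnegative ones. *)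
Lemma quadratic_ge n (Q : 'M[R]_n) l k :
  exists N, forall u, 0 <= quadratic Q l k u + N * (qform 1%:M u + 1).
Proof.
pose N := \sum_j \sum_i `|Q i j| + \sum_i `|l 0 i| + `|k|.
exists N => u; set r := qform 1%:M u.
have rE : r = \sum_i u i 0 ^+ 2 by exact: qform1E.
have r0 : 0 <= r by rewrite rE sumr_ge0// => i _; exact: sqr_ge0.
have ur i : u i 0 ^+ 2 <= r.
  by rewrite rE (bigD1 i)//= lerDl sumr_ge0// => j _; exact: sqr_ge0.
have u1 i : `|u i 0| <= r + 1.
  apply: (@le_trans _ _ (`|u i 0| ^+ 2 + 1)); last by rewrite lerD2r real_normK ?num_real.
  rewrite -subr_ge0 (_ : _ - _ = (`|u i 0| - 1 / 2) ^+ 2 + 3 / 4); last by field.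
  by rewrite addr_ge0 ?sqr_ge0.
have uu i j : `|u i 0| * `|u j 0| <= r + 1.
  have := ur i; have := ur j; rewrite -[u i 0 ^+ 2]real_normK ?num_real//.
  rewrite -[u j 0 ^+ 2]real_normK ?num_real//.
  have := sqr_ge0 (`|u i 0| - `|u j 0|); rewrite sqrrB; lra.
have Qr : `|qform Q u| <= (\sum_j \sum_i `|Q i j|) * (r + 1).
  rewrite /qform mxE (le_trans (ler_norm_sum _ _ _))// mulr_suml ler_sum// => j _.
  rewrite mxE mulr_suml (le_trans (ler_norm_sum _ _ _))// mulr_suml ler_sum// => i _.
  by rewrite mxE !normrM mulrAC mulrC ler_wpM2l.
have lr : `|(l *m u) 0 0| <= (\sum_i `|l 0 i|) * (r + 1).
  rewrite mxE (le_trans (ler_norm_sum _ _ _))// mulr_suml ler_sum// => i _.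
  by rewrite normrM ler_wpM2l.
have kr : `|k| <= `|k| * (r + 1) by rewrite ler_peMr// lerDr.
have : `|quadratic Q l k u| <= N * (r + 1).
  rewrite /quadratic /N !mulrDl; apply: (le_trans (ler_normD _ _)); apply: lerD => //.
  by apply: (le_trans (ler_normD _ _)); exact: lerD.
by rewrite ler_norml -subr_ge0 opprK => /andP[].
Qed.

Theorem gauss_quadratic n (m : 'cV[R]_n) S Q l k : posdefmx S ->
  has_integral (@lebesgue_rvec R n)
    (fun x => quadratic Q l k (col_of_pt x - m) * gauss_pdf m S x) (\tr (Q *m S) + k).
Proof.
move=> S_pos; have [N0 hN0] := quadratic_ge Q l k; pose N := Num.max N0 0.
have N_ge0 : 0 <= N by rewrite le_max lexx orbT.
have r1 u : 0 <= qform (1%:M : 'M[R]_n) u + 1.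
  by rewrite qform1E addr_ge0// sumr_ge0// => i _; exact: sqr_ge0.
have hN u : 0 <= quadratic Q l k u + N * (qform 1%:M u + 1).
  by apply: (le_trans (hN0 u)); rewrite lerD2l ler_wpM2r// le_max lexx.
have ge0 Q' l' k' : (forall u, 0 <= quadratic Q' l' k' u) ->
    has_integral (@lebesgue_rvec R n)
      (fun x => quadratic Q' l' k' (col_of_pt x - m) * gauss_pdf m S x) (\tr (Q' *m S) + k').
  move=> q0; apply: has_integral_ge0 => [|x|]; last exact: gauss_ge0_quadratic.
    by apply: measurable_funM; [exact: measurable_quadratic|exact: measurable_gauss_pdf].
  by rewrite mulr_ge0// gauss_pdf_ge0.
have qD u : quadratic (Q + N *: 1%:M) l (k + N) u =
    quadratic Q l k u + N * (qform 1%:M u + 1).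
  by rewrite /quadratic qform_addmx qform_scalemx; ring.
have qN u : quadratic (N *: 1%:M) 0 N u = N * (qform 1%:M u + 1).
  by rewrite /quadratic qform_scalemx mul0mx mxE; ring.
have h1 := ge0 (Q + N *: 1%:M) l (k + N); have h2 := ge0 (N *: 1%:M) 0 N.
apply: has_integral_ext (has_integralB (h1 _) (h2 _)) _ _ => [u|u|x|].
- by rewrite qD.
- by rewrite qN mulr_ge0.
- by rewrite /= qD qN; ring.
- by rewrite mulmxDl linearD /=; ring.
Qed.

Lemma gauss_mass n (m : 'cV[R]_n) S : posdefmx S ->
  has_integral (@lebesgue_rvec R n) (gauss_pdf m S) 1.
Proof.
move=> S_pos; apply: (has_integral_ext (@gauss_quadratic n m S 0 0 1 S_pos)) => [x|].
  by rewrite /quadratic /qform mulmx0 !mul0mx !mxE !add0r mul1r.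
by rewrite mul0mx mxtrace0 add0r.
Qed.

End gauss_integrals.

(** * Integrals against a density with a prescribed marginal *)

(** The integral of v may be infinite, so its positive and negative parts are compared
    separately with those of h. *)
Lemma has_integral_lower d (T : measurableType d) (R : realType)
    (mu : {measure set T -> \bar R}) (h v : T -> R) (c : R) :
  measurable_fun setT v -> has_integral mu h c -> (forall x, h x <= v x) ->
  (c%:E <= \int[mu]_x (v x)%:E)%E.
Proof.
move=> mv [hi <-] hv; have mh := measurable_int _ hi.
have mv' : measurable_fun setT (EFin \o v) by exact/measurable_EFinP.
rewrite integralE [leRHS]integralE; apply: leeB; apply: ge0_le_integral => //.
- exact: measurable_funepos.
- exact: measurable_funepos.
- by move=> x _; apply: (@funepos_le _ _ setT); rewrite ?inE// => y _; rewrite lee_fin.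
- exact: measurable_funeneg.
- exact: measurable_funeneg.
- by move=> x _; apply: (@funeneg_le _ _ setT); rewrite ?inE// => y _; rewrite lee_fin.
Qed.

Lemma measurable_EFin d (T : measurableType d) (R : realType) D (f : T -> R) :
  measurable_fun D f -> measurable_fun D (fun x => (f x)%:E).
Proof. by move=> mf; exact/measurable_EFinP. Qed.

Section marginals.

Context d1 d2 (T1 : measurableType d1) (T2 : measurableType d2) (R : realType).
Variables (mu1 : {sigma_finite_measure set T1 -> \bar R}).
Variables (mu2 : {sigma_finite_measure set T2 -> \bar R}).

Lemma integral_product_swap (f : T1 * T2 -> \bar R) : measurable_fun setT f ->
  (\int[product_measure1 mu1 mu2]_z f z =
   \int[product_measure1 mu2 mu1]_z f (unstable.swap z))%E.
Proof.
move=> mf; rewrite integralE [RHS](integralE _ _ (f \o unstable.swap)).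
have ge0_swap (h : T1 * T2 -> \bar R) : measurable_fun setT h -> (forall z, 0 <= h z)%E ->
    (\int[product_measure1 mu1 mu2]_z h z =
     \int[product_measure1 mu2 mu1]_z (h \o unstable.swap) z)%E.
  move=> mh h0; have mhs : measurable_fun setT (h \o @unstable.swap T2 T1).
    by apply: measurableT_comp => //; exact: measurable_swap.
  by rewrite (fubini_tonelli1 h)// (fubini_tonelli2 _ mhs)// => z; exact: h0.
rewrite (ge0_swap _ (measurable_funepos mf) (funepos_ge0 f)).
by rewrite (ge0_swap _ (measurable_funeneg mf) (funeneg_ge0 f)) -funepos_comp -funeneg_comp.
Qed.

(** The hypothesis on indicators says that the integral of f over its second
    argument is g almost everywhere. *)
Lemma integral_marginal (f : T1 * T2 -> R) (g phi : T1 -> R) :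
  measurable_fun setT f -> (forall z, 0 <= f z) ->
  mu1.-integrable setT (EFin \o g) -> (forall x, 0 <= g x) ->
  (forall A, measurable A ->
    \int[product_measure1 mu1 mu2]_z (\1_A z.1 * f z)%:E =
    \int[mu1]_(x in A) (g x)%:E)%E ->
  measurable_fun setT phi -> (forall x, 0 <= phi x) ->
  (\int[product_measure1 mu1 mu2]_z (phi z.1 * f z)%:E = \int[mu1]_x (phi x * g x)%:E)%E.
Proof.
move=> mf f0 gi g0 fA mphi phi0.
pose F x := (\int[mu2]_y (f (x, y))%:E)%E.
have mF : measurable_fun setT F.
  apply: (@measurable_fun_fubini_tonelli_F _ _ _ _ _ mu2 (EFin \o f)) => //.
  exact: measurable_EFin.
have F0 x : (0 <= F x)%E by apply: integral_ge0 => y _; rewrite lee_fin.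
have tonelli (h : T1 -> R) : measurable_fun setT h -> (forall x, 0 <= h x) ->
    (\int[product_measure1 mu1 mu2]_z (h z.1 * f z)%:E = \int[mu1]_x ((h x)%:E * F x))%E.
  move=> mh h0; rewrite (fubini_tonelli1 (fun z => (h z.1 * f z)%:E)).
  - apply: eq_integral => x _; rewrite /fubini_F /=.
    under eq_integral do rewrite EFinM.
    rewrite ge0_integralZl//.
    - apply: measurable_EFin; exact: (measurableT_comp mf (pair1_measurable x)).
    - by move=> y _; rewrite lee_fin.
    - by rewrite lee_fin.
  - apply: measurable_EFin; apply: measurable_funM => //.
    exact: measurableT_comp.
  - by move=> z; rewrite lee_fin mulr_ge0.
rewrite tonelli//.
have gF : ae_eq mu1 setT (EFin \o g) F.
  apply: integral_ae_eq => // A _ mA; rewrite -fA// tonelli//.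
  rewrite [RHS]integral_mkcond; apply: eq_integral => x _.
  by rewrite patchE indicE; case: (x \in A); rewrite ?mul1e ?mul0e.
have mg := measurable_int _ gi.
apply: ge0_ae_eq_integral => //.
- by apply: emeasurable_funM => //; exact/measurable_EFinP.
- apply/measurable_EFinP; apply: measurable_funM => //; exact/measurable_EFinP.
- by move=> x _; rewrite mule_ge0// lee_fin.
- by move=> x _; rewrite lee_fin mulr_ge0.
- by have /ae_eq_sym := ae_eqe_mul2l (EFin \o phi) gF.
Qed.

End marginals.

Section signed_marginals.

Context d1 d2 (T1 : measurableType d1) (T2 : measurableType d2) (R : realType).
Variables (mu1 : {sigma_finite_measure set T1 -> \bar R}).
Variables (mu2 : {sigma_finite_measure set T2 -> \bar R}).

(** The positive and negative parts of phi are integrated separately. *)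
Lemma has_integral_marginal1 (f : T1 * T2 -> R) (g phi : T1 -> R) (a : R) :
  measurable_fun setT f -> (forall z, 0 <= f z) ->
  mu1.-integrable setT (EFin \o g) -> (forall x, 0 <= g x) ->
  (forall A, measurable A ->
    \int[product_measure1 mu1 mu2]_z (\1_A z.1 * f z)%:E =
    \int[mu1]_(x in A) (g x)%:E)%E ->
  measurable_fun setT phi -> has_integral mu1 (fun x => phi x * g x) a ->
  has_integral (product_measure1 mu1 mu2) (fun z => phi z.1 * f z) a.
Proof.
move=> mf f0 gi g0 fA mphi phia.
have mg : measurable_fun setT g by apply/measurable_EFinP; exact: measurable_int gi.
pose pp x := Num.max (phi x) 0; pose pn x := Num.max (- phi x) 0.
have nonneg (h : T1 -> R) : measurable_fun setT h -> (forall x, 0 <= h x) ->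
    (forall x, h x <= `|phi x|) ->
    exists2 v, has_integral mu1 (fun x => h x * g x) v &
      has_integral (product_measure1 mu1 mu2) (fun z => h z.1 * f z) v.
  move=> mh h0 hphi.
  have [v hv] : exists v, has_integral mu1 (fun x => h x * g x) v.
    have phiN : has_integral mu1 (fun x => `|phi x * g x|)
        (fine (\int[mu1]_x (`|phi x * g x|)%:E)%E).
      have ii := integrable_norm phia.1.
      by split => //; rewrite fineK// integrable_fin_num.
    apply: (has_integral_dominated _ phiN) => [|x]; first exact: measurable_funM.
    by rewrite !normrM (ger0_norm (h0 x)) ler_wpM2r// normr_ge0.
  exists v => //; apply: has_integral_ge0 => [|z|].
  - by apply: measurable_funM => //; exact: measurableT_comp.
  - by rewrite mulr_ge0.
  - by rewrite (integral_marginal mf f0 gi g0 fA mh h0); case: hv.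
have mpp : measurable_fun setT pp by exact: measurable_maxr.
have mpn : measurable_fun setT pn.
  by apply: measurable_maxr => //; exact: measurableT_comp.
have [x|x|v1 h1 k1] := nonneg pp mpp; rewrite /pp.
- by rewrite le_max lexx orbT.
- by rewrite ge_max ler_norm normr_ge0.
have [x|x|v2 h2 k2] := nonneg pn mpn; rewrite /pn.
- by rewrite le_max lexx orbT.
- by rewrite ge_max ler_normr lexx orbT normr_ge0.
have ppn x : pp x - pn x = phi x.
  rewrite /pp /pn; case: (lerP 0 (phi x)) => p0.
    by rewrite max_r ?oppr_le0// subr0.
  by rewrite max_l ?oppr_ge0 ?ltW// sub0r opprK.
have ->: a = v1 - v2.
  have [_ aE] := phia; have [_] := has_integralB h1 h2.
  under eq_integral do rewrite -mulrBl ppn.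
  by rewrite aE => -[].
apply: (has_integral_ext (has_integralB k1 k2)) => // z.
by rewrite -mulrBl ppn.
Qed.

End signed_marginals.

Lemma has_integral_marginal2 d1 d2 (T1 : measurableType d1) (T2 : measurableType d2)
   (R : realType) (mu1 : {sigma_finite_measure set T1 -> \bar R})
   (mu2 : {sigma_finite_measure set T2 -> \bar R})
   (f : T1 * T2 -> R) (g phi : T2 -> R) (a : R) :
  measurable_fun setT f -> (forall z, 0 <= f z) ->
  mu2.-integrable setT (EFin \o g) -> (forall x, 0 <= g x) ->
  (forall A, measurable A ->
    \int[product_measure1 mu1 mu2]_z (\1_A z.2 * f z)%:E =
    \int[mu2]_(x in A) (g x)%:E)%E ->
  measurable_fun setT phi -> has_integral mu2 (fun x => phi x * g x) a ->
  has_integral (product_measure1 mu1 mu2) (fun z => phi z.2 * f z) a.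
Proof.
move=> mf f0 gi g0 fA mphi phia.
pose f' (z : T2 * T1) := f (unstable.swap z).
have mf' : measurable_fun setT f'.
  by apply: measurableT_comp => //; exact: measurable_swap.
have [|A mA|hi hE] := @has_integral_marginal1 _ _ T2 T1 R mu2 mu1 f' g phi a
    mf' _ gi g0 _ mphi phia.
- by move=> z; exact: f0.
- have mAf : measurable_fun setT (fun z : T1 * T2 => (\1_A z.2 * f z)%:E).
    by apply: measurable_EFin; apply: measurable_funM => //; exact: measurableT_comp.
  by rewrite -fA// (integral_product_swap mu1 mu2 mAf).
have mphif : measurable_fun setT (fun z : T1 * T2 => phi z.2 * f z).
  by apply: measurable_funM => //; exact: measurableT_comp.
have mE := measurable_EFin mphif.
have mA : measurable_fun setT (fun z : T1 * T2 => `|(phi z.2 * f z)%:E|%E).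
  exact: measurableT_comp.
split; last by rewrite (integral_product_swap mu1 mu2 mE).
apply/integrableP; split=> //; rewrite (integral_product_swap mu1 mu2 mA).
by have /integrableP[] := hi.
Qed.

(** * Duality for entropic transport *)

Lemma density_probability d (T : measurableType d) (R : realType)
    (mu : {measure set T -> \bar R}) (f : T -> R) :
  measurable_fun setT f -> (forall x, 0 <= f x) -> (\int[mu]_x (f x)%:E = 1)%E ->
  exists p : probability T R, forall A, measurable A -> p A = (\int[mu]_(x in A) (f x)%:E)%E.
Proof.
move=> mf f0 f1; pose m A := (\int[mu]_(x in A) (f x)%:E)%E.
have m0 : m set0 = 0%E by rewrite /m integral_set0.
have m_ge0 A : (0 <= m A)%E by apply: integral_ge0 => x _; rewrite lee_fin.
have m_sigma : semi_sigma_additive m.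
  move=> F mF tF mUF; rewrite /m ge0_integral_bigcup//=.
  - apply: is_cvg_ereal_nneg_natsum_cond => k _ _; exact: m_ge0.
  - by apply: measurable_funTS; exact: measurable_EFin.
  - by move=> x _; rewrite lee_fin.
pose mm := isMeasure.Build _ _ _ m m0 m_ge0 m_sigma.
pose M : {measure set T -> \bar R} := HB.pack m mm.
have M1 : M setT = 1%E by [].
pose pp := Measure_isProbability.Build _ _ _ (Measure.sort M) M1.
pose p : probability T R := HB.pack (Measure.sort M) pp.
by exists p.
Qed.

Section duality.

Variables (R : realType) (n : nat) (lambda : R).
Hypothesis lambda0 : 0 < lambda.
Local Notation leb := (@lebesgue_rvec R n).
Local Notation leb2 := (@lebesgue_rvec2 R n).
Variables (P Q : {measure set (rvec R n) -> \bar R}) (g1 g2 : rvec R n -> R).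
Hypothesis g1_mass : has_integral leb g1 1.
Hypothesis g2_mass : has_integral leb g2 1.
Hypothesis g1_ge0 : forall x, 0 <= g1 x.
Hypothesis g2_ge0 : forall x, 0 <= g2 x.
Hypothesis PE : forall A, measurable A -> P A = (\int[leb]_(x in A) (g1 x)%:E)%E.
Hypothesis QE : forall A, measurable A -> Q A = (\int[leb]_(x in A) (g2 x)%:E)%E.

(** The candidate for the optimal density; [potentials] below is its optimality
    condition. *)
Variable rho : rvec R n * rvec R n -> R.
Hypothesis mrho : measurable_fun setT rho.
Hypothesis rho_gt0 : forall z, 0 < rho z.
Hypothesis rho1 : forall x, (\int[leb]_y (rho (x, y))%:E = (g1 x)%:E)%E.
Hypothesis rho2 : forall y, (\int[leb]_x (rho (x, y))%:E = (g2 y)%:E)%E.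

(** The functions k1 and k2 make the transport cost of every coupling finite. *)
Variables (phi psi k1 k2 : rvec R n -> R) (a b c1 c2 : R).
Hypothesis mphi : measurable_fun setT phi.
Hypothesis mpsi : measurable_fun setT psi.
Hypothesis mk1 : measurable_fun setT k1.
Hypothesis mk2 : measurable_fun setT k2.
Hypothesis phi_a : has_integral leb (fun x => phi x * g1 x) a.
Hypothesis psi_b : has_integral leb (fun x => psi x * g2 x) b.
Hypothesis k1_c : has_integral leb (fun x => k1 x * g1 x) c1.
Hypothesis k2_c : has_integral leb (fun x => k2 x * g2 x) c2.
Hypothesis potentials :
  forall x y, sqdist x y + 4 * lambda * ln (rho (x, y)) = phi x + psi y.
Hypothesis sqdist_le : forall x y, sqdist x y <= k1 x + k2 y.

Definition density_with_marginals (f : rvec R n * rvec R n -> R) :=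
  [/\ measurable_fun setT f, forall z, 0 <= f z,
   forall A, measurable A ->
     (\int[leb2]_z (\1_A z.1 * f z)%:E = \int[leb]_(x in A) (g1 x)%:E)%E &
   forall A, measurable A ->
     (\int[leb2]_z (\1_A z.2 * f z)%:E = \int[leb]_(x in A) (g2 x)%:E)%E].

Lemma sqdist_ge0 (x y : rvec R n) : 0 <= sqdist x y.
Proof. by apply: sumr_ge0 => i _; exact: sqr_ge0. Qed.

Lemma measurable_sqdist :
  measurable_fun setT (fun z : rvec R n * rvec R n => sqdist z.1 z.2).
Proof.
apply: measurable_sum => i; apply: measurable_funX; apply: measurable_funB.
  by apply: (measurableT_comp (measurable_tnth i)).
by apply: (measurableT_comp (measurable_tnth i)).
Qed.

(** Minorant of f ln f from Gibbs' inequality, with ln rho expressed by means of the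
    potentials: its integral depends on f only through the transport cost. *)
Let h f (z : rvec R n * rvec R n) :=
  (4 * lambda)^-1 * ((phi z.1 * f z + psi z.2 * f z) - sqdist z.1 z.2 * f z) +
  (f z - rho z).

Lemma marginals_int1 f (u : rvec R n -> R) (c : R) :
  density_with_marginals f -> measurable_fun setT u ->
  has_integral leb (fun x => u x * g1 x) c -> has_integral leb2 (fun z => u z.1 * f z) c.
Proof.
move=> [mf f0 f1 _] mu uc.
by apply: (has_integral_marginal1 mf f0 g1_mass.1 g1_ge0 f1 mu uc).
Qed.

Lemma marginals_int2 f (u : rvec R n -> R) (c : R) :
  density_with_marginals f -> measurable_fun setT u ->
  has_integral leb (fun x => u x * g2 x) c -> has_integral leb2 (fun z => u z.2 * f z) c.
Proof.
move=> [mf f0 _ f2] mu uc.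
by apply: (has_integral_marginal2 mf f0 g2_mass.1 g2_ge0 f2 mu uc).
Qed.

Lemma marginals_mass f : density_with_marginals f -> has_integral leb2 f 1.
Proof.
move=> df; have := @marginals_int1 f (fun=> 1) 1 df (measurable_cst _).
have e1 : (fun x => 1 * g1 x) = g1 by apply/funext => x; rewrite mul1r.
rewrite e1 => /(_ g1_mass); congr has_integral.
by apply/funext => z; rewrite mul1r.
Qed.

Lemma ge0_integral_leb2 (F : rvec R n * rvec R n -> R) : measurable_fun setT F ->
  (forall z, 0 <= F z) ->
  (\int[leb2]_z (F z)%:E = \int[leb]_x \int[leb]_y (F (x, y))%:E)%E /\
  (\int[leb2]_z (F z)%:E = \int[leb]_y \int[leb]_x (F (x, y))%:E)%E.
Proof.
move=> mF F0; have mE := measurable_EFin mF.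
have E0 z : (0 <= (F z)%:E)%E by rewrite lee_fin.
split; first exact: (fubini_tonelli1 (fun z => (F z)%:E) mE E0).
exact: (fubini_tonelli2 (fun z => (F z)%:E) mE E0).
Qed.

Lemma rho_marginals : density_with_marginals rho.
Proof.
have rho0 z : 0 <= rho z by exact/ltW.
split=> // A mA.
- have mF : measurable_fun setT (fun z : rvec R n * rvec R n => \1_A z.1 * rho z).
    by apply: measurable_funM => //; exact: measurableT_comp.
  have [-> _] := ge0_integral_leb2 mF (fun z => mulr_ge0 (ler0n _ _) (rho0 z)).
  rewrite [RHS]integral_mkcond; apply: eq_integral => x _.
  under eq_integral do rewrite /= EFinM.
  rewrite ge0_integralZl//.
  - by rewrite rho1 patchE indicE; case: (x \in A); rewrite ?mul1e ?mul0e.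
  - by apply: measurable_EFin; exact: (measurableT_comp mrho (pair1_measurable x)).
  - by move=> y _; rewrite lee_fin.
- have mF : measurable_fun setT (fun z : rvec R n * rvec R n => \1_A z.2 * rho z).
    by apply: measurable_funM => //; exact: measurableT_comp.
  have [_ ->] := ge0_integral_leb2 mF (fun z => mulr_ge0 (ler0n _ _) (rho0 z)).
  rewrite [RHS]integral_mkcond; apply: eq_integral => y _.
  under eq_integral do rewrite /= EFinM.
  rewrite ge0_integralZl//.
  - by rewrite rho2 patchE indicE; case: (y \in A); rewrite ?mul1e ?mul0e.
  - by apply: measurable_EFin; exact: (measurableT_comp mrho (pair2_measurable y)).
  - by move=> x _; rewrite lee_fin.
Qed.

Lemma sqdist_integral f : density_with_marginals f ->
  exists u, has_integral leb2 (fun z => sqdist z.1 z.2 * f z) u.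
Proof.
move=> df; have [mf f0 _ _] := df.
have := has_integralD (marginals_int1 df mk1 k1_c) (marginals_int2 df mk2 k2_c).
move=> /has_integral_dominated; apply.
  by apply: measurable_funM => //; exact: measurable_sqdist.
move=> [x y] /=; rewrite ger0_norm; last by rewrite mulr_ge0 ?sqdist_ge0.
by rewrite -mulrDl ler_wpM2r.
Qed.

Lemma entropy_minorant f u : density_with_marginals f ->
  has_integral leb2 (fun z => sqdist z.1 z.2 * f z) u ->
  has_integral leb2 (h f) ((4 * lambda)^-1 * (a + b - u)).
Proof.
move=> df fu.
have h1 := has_integralZ (4 * lambda)^-1 (has_integralB
  (has_integralD (marginals_int1 df mphi phi_a) (marginals_int2 df mpsi psi_b)) fu).
have h2 := has_integralB (marginals_mass df) (marginals_mass rho_marginals).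
by apply: has_integral_ext (has_integralD h1 h2) _ _ => //; rewrite subrr addr0.
Qed.

Lemma minorantE f z : h f z = f z * ln (rho z) + (f z - rho z).
Proof.
case: z => x y; rewrite /h /= -mulrDl -potentials; congr (_ + _).
by field; rewrite gt_eqF.
Qed.

(** In the integral of the minorant the transport cost has coefficient
    - 1 / (4 lambda), so it cancels out of the total. *)
Lemma cost_lower_bound f u : density_with_marginals f ->
  has_integral leb2 (fun z => sqdist z.1 z.2 * f z) u ->
  ((a + b)%:E <= (\int[leb2]_z (sqdist z.1 z.2 * f z)%:E) - (4 * lambda)%:E * Ent f)%E.
Proof.
move=> df fu; have [mf f0 _ _] := df.
rewrite fu.2 /Ent muleN oppeK.
have l40 : 0 < 4 * lambda by rewrite mulr_gt0.
have -> : a + b = u + 4 * lambda * ((4 * lambda)^-1 * (a + b - u)).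
  by field; rewrite gt_eqF.
rewrite EFinD leeD2l// EFinM lee_pmul2l ?lte_fin//.
apply: has_integral_lower (entropy_minorant df fu) _.
  by apply: measurable_funM => //; exact: measurableT_comp.
move=> z; rewrite minorantE; have := ln_gibbs (rho_gt0 z) (f0 z).
by rewrite -subr_ge0 -[in X in _ -> X]subr_ge0; congr (is_true (0 <= _)); ring.
Qed.

Lemma cost_rho u : has_integral leb2 (fun z => sqdist z.1 z.2 * rho z) u ->
  ((\int[leb2]_z (sqdist z.1 z.2 * rho z)%:E) - (4 * lambda)%:E * Ent rho = (a + b)%:E)%E.
Proof.
move=> ru; rewrite ru.2 /Ent muleN oppeK.
under eq_integral => z _.
  rewrite (_ : rho z * ln (rho z) = h rho z); last by rewrite minorantE subrr addr0.
  over.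
rewrite (entropy_minorant rho_marginals ru).2 -EFinM -EFinD; congr EFin.
by field; rewrite gt_eqF.
Qed.

Lemma indicator_fst A (f : rvec R n * rvec R n -> R) :
  (\int[leb2]_(z in fst @^-1` A) (f z)%:E = \int[leb2]_z (\1_A z.1 * f z)%:E)%E.
Proof.
rewrite integral_mkcond; apply: eq_integral => z _; rewrite patchE indicE.
rewrite (_ : (z \in fst @^-1` A) = (z.1 \in A)); last by apply/idP/idP; rewrite !inE.
by case: (_ \in _); rewrite ?mul1r ?mul0r.
Qed.

Lemma indicator_snd A (f : rvec R n * rvec R n -> R) :
  (\int[leb2]_(z in snd @^-1` A) (f z)%:E = \int[leb2]_z (\1_A z.2 * f z)%:E)%E.
Proof.
rewrite integral_mkcond; apply: eq_integral => z _; rewrite patchE indicE.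
rewrite (_ : (z \in snd @^-1` A) = (z.2 \in A)); last by apply/idP/idP; rewrite !inE.
by case: (_ \in _); rewrite ?mul1r ?mul0r.
Qed.

Lemma coupling_density_marginals p f : couplings P Q p -> is_density p f ->
  density_with_marginals f.
Proof.
move=> [pP pQ _] [mf f0 pf]; split=> // A mA.
- have mA1 : measurable (fst @^-1` A : set (rvec R n * rvec R n)).
    by rewrite -[X in measurable X]setTI; exact: measurable_fst.
  by rewrite -PE// -pP// /pushforward pf// indicator_fst.
- have mA2 : measurable (snd @^-1` A : set (rvec R n * rvec R n)).
    by rewrite -[X in measurable X]setTI; exact: measurable_snd.
  by rewrite -QE// -pQ// /pushforward pf// indicator_snd.
Qed.

Lemma rho_coupling : exists p, couplings P Q p /\ is_density p rho.
Proof.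
have rho0 z : 0 <= rho z by exact/ltW.
have [_ _ r1 r2] := rho_marginals.
have [p pE] := density_probability mrho rho0 (marginals_mass rho_marginals).2.
exists p; split; last by split.
split=> [A mA|A mA|].
- have mA1 : measurable (fst @^-1` A : set (rvec R n * rvec R n)).
    by rewrite -[X in measurable X]setTI; exact: measurable_fst.
  by rewrite /pushforward pE// indicator_fst r1// PE.
- have mA2 : measurable (snd @^-1` A : set (rvec R n * rvec R n)).
    by rewrite -[X in measurable X]setTI; exact: measurable_snd.
  by rewrite /pushforward pE// indicator_snd r2// QE.
apply/null_content_dominatesP => A mA A0; rewrite pE//.
by apply: null_set_integral => //; apply: measurable_funTS; exact: measurable_EFin.
Qed.

Theorem eot_cost_dual : eot_cost lambda P Q = (a + b)%:E.
Proof.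
apply/eqP; rewrite eq_le; apply/andP; split.
  have [p [pc pd]] := rho_coupling; have [u ru] := sqdist_integral rho_marginals.
  by apply: ereal_inf_lbound; exists p, rho; split=> //; rewrite (cost_rho ru).
apply: le_ereal_inf_tmp => _ [p [f [pc pd ->]]].
have df := coupling_density_marginals pc pd; have [u fu] := sqdist_integral df.
exact: (cost_lower_bound df fu).
Qed.

End duality.

(** * The optimal Gaussian coupling *)

Section gaussian_coupling.

Variables (R : realType) (n : nat).
Implicit Types (A B S : 'M[R]_n) (u v m : 'cV[R]_n).

Definition dotv u v : R := (u^T *m v) 0 0.

(** Completing the square. *)
Lemma qform_sym_shift B c u v : B^T = B -> B \in unitmx ->
  qform B (v - c *: (invmx B *m u)) =
  qform B v - 2 * c * dotv u v + c ^+ 2 * qform (invmx B) u.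
Proof.
move=> BT Bu.
have dotC : dotv v u = dotv u v.
  by rewrite /dotv !mxE; apply: eq_bigr => i _; rewrite !mxE mulrC.
rewrite -scaleNr qformD qformZ -scalemxAr [(- c *: _)^T]linearZ /= -!scalemxAl.
rewrite trmx_mul trmx_inv BT.
have -> : qform B (invmx B *m u) = qform (invmx B) u.
  by rewrite /qform trmx_mul trmx_inv BT mulmxKV// mulmxA.
rewrite -[v^T *m B *m _]mulmxA mulKVmx// mulmxKV//.
have scaleE a (M : 'M[R]_1) : (a *: M) 0 0 = a * M 0 0 by rewrite mxE.
rewrite !scaleE -/(dotv u v) -/(dotv v u) dotC; ring.
Qed.

(** The quadratic form with diagonal blocks A, B and off-diagonal blocks - c. *)
Definition coupled_form c A B u v : R := qform A u + qform B v - 2 * c * dotv u v.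

(** Marginal of x times density of y given x.  Exchanging the roles of A and B gives
    the other factorization of the same function. *)
Lemma gauss_pdf_conditional c A B S m1 m2 x y : posdefmx B ->
  invmx S = A - c ^+ 2 *: invmx B ->
  gauss_pdf m1 S x * gauss_pdf (m2 + c *: (invmx B *m (col_of_pt x - m1))) (invmx B) y =
  ((Num.sqrt ((2 * pi) ^+ n * \det S))^-1 * (Num.sqrt ((2 * pi) ^+ n * \det (invmx B)))^-1) *
  expR (- (coupled_form c A B (col_of_pt x - m1) (col_of_pt y - m2) / 2)).
Proof.
move=> B_pos SE; rewrite !gauss_pdfE mulrACA -expRD; congr (_ * expR _).
rewrite SE invmxK opprD addrA qform_sym_shift ?posdef_unitmx ?B_pos.1//.
rewrite /coupled_form; set u := col_of_pt x - m1; set v := col_of_pt y - m2.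
rewrite qform_submx; by field.
Qed.

End gaussian_coupling.

Section gaussian_eot.

Variables (R : realType) (n : nat) (lambda : R) (m1 m2 : 'cV[R]_n).

(** Changing basis by P in the first factor and by P^-T in the second keeps the
    pairing of x and y and makes both covariances diagonal. *)
Variables (P : 'M[R]_n) (y : 'I_n -> R).
Hypotheses (lambda0 : 0 < lambda) (Pu : P \in unitmx) (y0 : forall i, 0 < y i).
Local Notation leb := (@lebesgue_rvec R n).

Let pdg (s : 'I_n -> R) : 'M[R]_n := P *m diag_of s *m P^T.

Let qdg (s : 'I_n -> R) : 'M[R]_n := (invmx P)^T *m diag_of s *m invmx P.

Let pqdg s s' : (forall i, s i * s' i = 1) -> pdg s *m qdg s' = 1%:M.
Proof.
move=> ss; rewrite /pdg /qdg !mulmxA -(mulmxA _ P^T) -trmx_mul mulVmx// trmx1 mulmx1.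
by rewrite -(mulmxA P) diag_ofM (eq_diag_of ss) diag_of1 mulmx1 mulmxV.
Qed.

Let invmx_pdg s s' : (forall i, s i * s' i = 1) -> invmx (pdg s) = qdg s'.
Proof. by move=> ss; apply: invmx_eq; exact: pqdg. Qed.

Let invmx_qdg s s' : (forall i, s i * s' i = 1) -> invmx (qdg s) = pdg s'.
Proof.
by move=> ss; apply: invmx_eq; apply: mulmx1C; apply: pqdg => i; rewrite mulrC.
Qed.

Let posdef_pdg s : (forall i, 0 < s i) -> posdefmx (pdg s).
Proof.
move=> s0; rewrite /pdg -{1}[P]trmxK; apply: posdef_conj; first by rewrite unitmx_tr.
exact: posdef_diag_of.
Qed.

Let posdef_qdg s : (forall i, 0 < s i) -> posdefmx (qdg s).
Proof. by move=> s0; apply: posdef_conj; [rewrite unitmx_inv|exact: posdef_diag_of]. Qed.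

Let pdgB c s s' : pdg s - c *: pdg s' = pdg (fun i => s i - c * s' i).
Proof.
rewrite /pdg scalemxAl scalemxAr -mulmxBl -mulmxBr; congr (_ *m _ *m _).
by apply/matrixP => i j; rewrite !mxE; case: eqVneq => _; rewrite ?mulr1n// !mulr0n; ring.
Qed.

Let qdgB c s s' : qdg s - c *: qdg s' = qdg (fun i => s i - c * s' i).
Proof.
rewrite /qdg scalemxAl scalemxAr -mulmxBl -mulmxBr; congr (_ *m _ *m _).
by apply/matrixP => i j; rewrite !mxE; case: eqVneq => _; rewrite ?mulr1n// !mulr0n; ring.
Qed.

Let det_pqdg s s' : \det (pdg s) * \det (qdg s') = \prod_i (s i * s' i).
Proof.
rewrite -det_mulmx /pdg /qdg !mulmxA -(mulmxA _ P^T) -trmx_mul mulVmx// trmx1 mulmx1.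
by rewrite -(mulmxA P) diag_ofM !det_mulmx mulrAC -det_mulmx mulmxV// det1 mul1r det_diag_of.
Qed.

Let tr_pqdg s s' : \tr (qdg s *m pdg s') = \sum_i s i * s' i.
Proof.
rewrite mxtrace_mulC /pdg /qdg !mulmxA -(mulmxA _ P^T) -trmx_mul mulVmx// trmx1 mulmx1.
rewrite -(mulmxA P) diag_ofM mxtrace_mulC !mulmxA mulVmx// mul1mx.
by rewrite /mxtrace; apply: eq_bigr => i _; rewrite !mxE eqxx mulr1n mulrC.
Qed.

Let c : R := (2 * lambda)^-1.

Let c0 : 0 < c. Proof. by rewrite invr_gt0 mulr_gt0. Qed.

Let t i := tau c (y i).

Let t0 i : 0 < t i. Proof. exact: tau_gt0. Qed.

Let tE i : t i + c ^+ 2 * t i ^+ 2 = y i. Proof. exact: tauE. Qed.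

Let S1 := pdg (fun=> 1).

Let S2 := qdg y.

(** The diagonal blocks of the precision matrix of the optimal coupling. *)
Let A := qdg (fun i => y i / t i).

Let B := pdg (fun i => (t i)^-1).

Let yt0 i : 0 < y i / t i. Proof. by rewrite divr_gt0. Qed.

Let invt0 i : 0 < (t i)^-1. Proof. by rewrite invr_gt0. Qed.

Let S1_pos : posdefmx S1. Proof. by apply: posdef_pdg => i. Qed.

Let S2_pos : posdefmx S2. Proof. exact: posdef_qdg. Qed.

Let A_pos : posdefmx A. Proof. exact: posdef_qdg. Qed.

Let B_pos : posdefmx B. Proof. exact: posdef_pdg. Qed.

Let invB : invmx B = qdg t.
Proof. by apply: invmx_pdg => i; rewrite mulVf// gt_eqF. Qed.

Let invA : invmx A = pdg (fun i => t i / y i).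
Proof. by apply: invmx_qdg => i; field; rewrite !gt_eqF. Qed.

(** The inverse covariance of a marginal is a Schur complement of the precision
    matrix; for both marginals this amounts to t + c^2 t^2 = y. *)
Let invS1 : invmx S1 = A - c ^+ 2 *: invmx B.
Proof.
rewrite invB qdgB; apply: invmx_pdg => i; rewrite mul1r -tE.
by field; rewrite gt_eqF.
Qed.

Let invS2 : invmx S2 = B - c ^+ 2 *: invmx A.
Proof.
rewrite invA pdgB; apply: invmx_qdg => i.
have -> : y i * ((t i)^-1 - c ^+ 2 * (t i / y i)) = (y i - c ^+ 2 * t i ^+ 2) / t i.
  by field; rewrite !gt_eqF.
by rewrite -{1}tE addrK divff// gt_eqF.
Qed.

Let T := \prod_i t i.

Let T0 : 0 < T. Proof. by apply: prodr_gt0. Qed.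

Let det1E : \det S1 * \det (invmx B) = T.
Proof. by rewrite invB det_pqdg; apply: eq_bigr => i _; rewrite mul1r. Qed.

Let det2E : \det S2 * \det (invmx A) = T.
Proof.
rewrite invA mulrC det_pqdg; apply: eq_bigr => i _.
by field; rewrite gt_eqF.
Qed.

Let K := (Num.sqrt ((2 * pi) ^+ (n + n) * T))^-1.

Let KE d d' : 0 < d -> d * d' = T ->
  (Num.sqrt ((2 * pi) ^+ n * d))^-1 * (Num.sqrt ((2 * pi) ^+ n * d'))^-1 = K.
Proof.
move=> d0 dT; rewrite -invfM -sqrtrM; last first.
  by rewrite mulr_ge0 ?(ltW d0)// exprn_ge0// mulr_ge0// pi_ge0.
by rewrite /K -dT exprD; congr (Num.sqrt _)^-1; ring.
Qed.

Let K0 : 0 < K.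
Proof. by rewrite invr_gt0 sqrtr_gt0 mulr_gt0// exprn_gt0// mulr_gt0// pi_gt0. Qed.

Let lnK : ln K = - (((n + n)%:R * ln (2 * pi) + \sum_i ln (t i)) / 2).
Proof.
have p0 : 0 < 2 * pi :> R by rewrite mulr_gt0// pi_gt0.
rewrite /K lnV ?posrE; last by rewrite sqrtr_gt0 mulr_gt0// exprn_gt0.
congr (- _); set X := _ * T; have X0 : 0 < X by rewrite mulr_gt0// exprn_gt0.
have -> : (n + n)%:R * ln (2 * pi) + \sum_i ln (t i) = ln X.
  by rewrite [RHS]lnM ?posrE ?exprn_gt0// lnXn// ln_prod// mulr_natl.
have -> : ln X = ln (Num.sqrt X) *+ 2 by rewrite -lnXn ?sqrtr_gt0// sqr_sqrtr// ltW.
by field.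
Qed.

Let rho (z : rvec R n * rvec R n) : R :=
  K * expR (- (coupled_form c A B (col_of_pt z.1 - m1) (col_of_pt z.2 - m2) / 2)).

Let rho_fst x z : rho (x, z) =
  gauss_pdf m1 S1 x * gauss_pdf (m2 + c *: (invmx B *m (col_of_pt x - m1))) (invmx B) z.
Proof.
by rewrite (gauss_pdf_conditional m1 m2 x z B_pos invS1) (KE (posdef_det_gt0 S1_pos) det1E).
Qed.

Let rho_snd x z : rho (x, z) =
  gauss_pdf m2 S2 z * gauss_pdf (m1 + c *: (invmx A *m (col_of_pt z - m2))) (invmx A) x.
Proof.
rewrite (gauss_pdf_conditional m2 m1 z x A_pos invS2) (KE (posdef_det_gt0 S2_pos) det2E).
rewrite /rho /coupled_form /=
  (_ : dotv (col_of_pt z - m2) _ = dotv (col_of_pt x - m1) (col_of_pt z - m2)).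
  by rewrite [qform A _ + _]addrC.
by rewrite /dotv !mxE; apply: eq_bigr => i _; rewrite !mxE mulrC.
Qed.

Let rho_gt0 z : 0 < rho z. Proof. by rewrite mulr_gt0// expR_gt0. Qed.

Let mrho : measurable_fun setT rho.
Proof.
apply: measurable_funM => //; apply: measurableT_comp => //; apply: measurableT_comp => //.
apply: measurable_funM => //; apply: measurable_funB.
  by apply: measurable_funD; exact: (measurableT_comp (measurable_qform _ _)).
apply: measurable_funM => //.
pose q (z : rvec R n * rvec R n) := \sum_j (tnth z.1 j - m1 j 0) * (tnth z.2 j - m2 j 0).
suff mq : measurable_fun setT q.
  apply: eq_measurable_fun mq => z _; rewrite /q /dotv mxE; apply: eq_bigr => j _.
  by rewrite !mxE.
apply: measurable_sum => j; apply: measurable_funM; apply: measurable_funB => //.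
  exact: (measurableT_comp (measurable_tnth j)).
exact: (measurableT_comp (measurable_tnth j)).
Qed.

Let rho_marginal1 x : (\int[leb]_z (rho (x, z))%:E = (gauss_pdf m1 S1 x)%:E)%E.
Proof.
have invB_pos : posdefmx (invmx B) by rewrite invB; exact: posdef_qdg.
have [_] := has_integralZ (gauss_pdf m1 S1 x)
  (gauss_mass (m2 + c *: (invmx B *m (col_of_pt x - m1))) invB_pos).
by rewrite mulr1 => <-; apply: eq_integral => z _; rewrite rho_fst.
Qed.

Let rho_marginal2 z : (\int[leb]_x (rho (x, z))%:E = (gauss_pdf m2 S2 z)%:E)%E.
Proof.
have invA_pos : posdefmx (invmx A).
  by rewrite invA; apply: posdef_pdg => i; rewrite divr_gt0.
have [_] := has_integralZ (gauss_pdf m2 S2 z)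
  (gauss_mass (m1 + c *: (invmx A *m (col_of_pt z - m2))) invA_pos).
by rewrite mulr1 => <-; apply: eq_integral => x _; rewrite rho_snd.
Qed.

Let delta := m1 - m2.

Let sqdistE x z : sqdist x z = qform 1%:M (col_of_pt x - m1) + qform 1%:M (col_of_pt z - m2) +
  qform 1%:M delta - 2 * dotv (col_of_pt x - m1) (col_of_pt z - m2) +
  (2 * dotv delta (col_of_pt x - m1) - 2 * dotv delta (col_of_pt z - m2)).
Proof.
rewrite !qform1E /dotv !mxE !mulr_sumr -!sumrB -!big_split /= -!sumrB -!big_split /=.
by apply: eq_bigr => i _; rewrite !mxE; ring.
Qed.

Let sqdist_dominated x z : sqdist x z <=
  quadratic (3%:M) 0 (3 * qform 1%:M delta) (col_of_pt x - m1) +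
  quadratic (3%:M) 0 0 (col_of_pt z - m2).
Proof.
have q3 u : qform (3%:M : 'M[R]_n) u = 3 * qform 1%:M u.
  by rewrite -scalemx1 qform_scalemx.
rewrite /quadratic !q3 !mul0mx !mxE !addr0 !qform1E !mulr_sumr -!big_split /=.
apply: ler_sum => i _; rewrite !mxE.
set p := tnth x i - m1 i 0; set q := tnth z i - m2 i 0; set r := m1 i 0 - m2 i 0.
have -> : tnth x i - tnth z i = p - q + r by rewrite /p /q /r; ring.
have := sqr_ge0 (p + q); have := sqr_ge0 (p - r); have := sqr_ge0 (q + r).
rewrite !expr2; lra.
Qed.

Let kappa := qform 1%:M delta + 4 * lambda * ln K.

(** The cross terms cancel because 4 lambda c = 2. *)
Let potentials x z : sqdist x z + 4 * lambda * ln (rho (x, z)) =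
  quadratic (1%:M - (2 * lambda) *: A) (2 *: delta^T) kappa (col_of_pt x - m1) +
  quadratic (1%:M - (2 * lambda) *: B) (- 2 *: delta^T) 0 (col_of_pt z - m2).
Proof.
rewrite sqdistE /rho lnM ?posrE ?expR_gt0// expRK /coupled_form /kappa /quadratic /=.
rewrite !qform_submx.
have lE (k : R) u : ((k *: delta^T) *m u) 0 0 = k * dotv delta u.
  by rewrite -scalemxAl mxE.
rewrite !lE.
move: (dotv (col_of_pt x - m1) _) (dotv delta (col_of_pt x - m1)) => d1 d2.
move: (dotv delta (col_of_pt z - m2)) => d3.
move: (qform 1%:M (col_of_pt x - m1)) (qform 1%:M (col_of_pt z - m2)) => q1 q2.
move: (qform 1%:M delta) => q3.
move: (qform A _) (qform B _) (ln K) => q4 q5 l.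
by rewrite /c; field; rewrite gt_eqF.
Qed.

Let trA : \tr ((1%:M - (2 * lambda) *: A) *m S1) = \tr S1 - 2 * lambda * \sum_i y i / t i.
Proof.
rewrite mulmxBl mul1mx -scalemxAl linearB /= mxtraceZ tr_pqdg.
by congr (_ - _ * _); apply: eq_bigr => i _; rewrite mulr1.
Qed.

Let trB : \tr ((1%:M - (2 * lambda) *: B) *m S2) = \tr S2 - 2 * lambda * \sum_i y i / t i.
Proof.
have <- : \tr (B *m S2) = \sum_i y i / t i by rewrite mxtrace_mulC tr_pqdg.
by rewrite mulmxBl mul1mx -scalemxAl linearB /= mxtraceZ.
Qed.

Lemma eot_cost_gauss_basis : eot_cost lambda (gauss m1 S1) (gauss m2 S2) =
  (\tr S1 + \tr S2 +
    (qform 1%:M delta - 2 * lambda * ((n + n)%:R * ln (2 * pi) + 2 * n%:R)) +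
    2 * lambda * \sum_i spectral_cost c (y i))%:E.
Proof.
rewrite (@eot_cost_dual _ _ _ lambda0 (gauss m1 S1) (gauss m2 S2) _ _
  (gauss_mass m1 S1_pos) (gauss_mass m2 S2_pos)
  (gauss_pdf_ge0 m1 S1) (gauss_pdf_ge0 m2 S2) (fun _ _ => erefl) (fun _ _ => erefl)
  rho mrho rho_gt0 rho_marginal1 rho_marginal2
  _ _ _ _ _ _ _ _ (measurable_quadratic _ _ _ _) (measurable_quadratic _ _ _ _)
  (measurable_quadratic _ _ _ _) (measurable_quadratic _ _ _ _)
  (gauss_quadratic m1 _ _ _ S1_pos) (gauss_quadratic m2 _ _ _ S2_pos)
  (gauss_quadratic m1 _ _ _ S1_pos) (gauss_quadratic m2 _ _ _ S2_pos)
  potentials sqdist_dominated).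
congr EFin; rewrite trA trB /kappa lnK.
have -> : \sum_i y i / t i = n%:R + c ^+ 2 * \sum_i t i.
  rewrite (eq_bigr (fun i => 1 + c ^+ 2 * t i)); last first.
    by move=> i _; rewrite -tE; field; rewrite gt_eqF.
  by rewrite big_split /= -mulr_sumr sumr_const card_ord.
have -> : \sum_i spectral_cost c (y i) =
    - (\sum_i ln (t i) + 2 * c ^+ 2 * \sum_i t i).
  by rewrite /spectral_cost sumrN big_split /= -mulr_sumr.
move: (\sum_i t i) (\sum_i ln (t i)) (ln (2 * pi)) (qform _ _) (\tr S1) (\tr S2).
move=> a1 a2 a3 a4 a5 a6.
by field.
Qed.

End gaussian_eot.

(** * Optimal covariances in an isospectral class *)

Section optimal_covariance.

Variables (R : realType) (n : nat).
Implicit Types (S L G : 'M[R]_n) (a b y : 'I_n -> R).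

Definition eot_shift (lambda : R) (m1 m2 : 'cV[R]_n) : R :=
  qform 1%:M (m1 - m2) - 2 * lambda * ((n + n)%:R * ln (2 * pi) + 2 * n%:R).

(** If V^T diag(y) V diagonalizes L^T S2 L, then P = L V^T satisfies S1 = P P^T and
    S2 = P^-T diag(y) P^-1. *)
Theorem eot_cost_gauss lambda m1 m2 L S2 y : 0 < lambda -> L \in unitmx ->
  posdefmx S2 -> has_spectrum (L^T *m S2 *m L) y ->
  eot_cost lambda (gauss m1 (L *m L^T)) (gauss m2 S2) =
  (\tr (L *m L^T) + \tr S2 + eot_shift lambda m1 m2 +
   2 * lambda * \sum_i spectral_cost (2 * lambda)^-1 (y i))%:E.
Proof.
move=> l0 Lu S2_pos Ly.
have y0 : forall i, 0 < y i by apply/(posdef_spectrum Ly); exact: posdef_conj.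
have [V Vo LE] := Ly; pose P := L *m V^T.
have Vu := orthogonal_unitmx Vo.
have Pu : P \in unitmx by rewrite unitmx_mul Lu unitmx_tr.
have PP : P *m diag_of (fun=> 1) *m P^T = L *m L^T.
  by rewrite diag_of1 mulmx1 /P trmx_mul trmxK mulmxA -(mulmxA L) Vo mulmx1.
have PV : invmx P = V *m invmx L.
  by apply: invmx_eq; rewrite /P mulmxA -(mulmxA L) Vo mulmx1 mulmxV.
have PS : (invmx P)^T *m diag_of y *m invmx P = S2.
  have -> : (invmx P)^T *m diag_of y *m invmx P =
      (invmx L)^T *m (V^T *m diag_of y *m V) *m invmx L.
    by rewrite PV trmx_mul !mulmxA.
  rewrite -LE.
  by rewrite !mulmxA -trmx_mul mulmxV// trmx1 mul1mx mulmxK.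
by have := eot_cost_gauss_basis m1 m2 l0 Pu y0; rewrite PP PS.
Qed.

(** Lidskii's inequality for initial segments: the partial sums of ln y are at
    most those of ln (a * b). *)
Lemma sum_spectral_cost_ge c L S2 a b y : 0 < c -> L \in unitmx ->
  antitone a -> antitone b -> antitone y -> (forall i, 0 < b i) ->
  has_spectrum (L^T *m L) a -> has_spectrum S2 b -> has_spectrum (L^T *m S2 *m L) y ->
  \sum_i spectral_cost c (a i * b i) <= \sum_i spectral_cost c (y i).
Proof.
move=> c0 Lu a_anti b_anti y_anti b0 La S2b LS2y.
have a0 : forall i, 0 < a i.
  by apply/(posdef_spectrum La); exact: posdef_gram.
have y0 : forall i, 0 < y i.
  by apply/(posdef_spectrum LS2y)/posdef_conj => //; apply/(posdef_spectrum S2b).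
apply: sum_spectral_cost_le => // [i|k]; first by rewrite mulr_gt0.
have := lidskii_mul 1%g k Lu a_anti b_anti y_anti b0 La S2b LS2y.
rewrite -subr_le0 -sumrB; congr (_ <= 0); apply: eq_bigr => i _.
by rewrite perm1 lnM ?posrE// opprD addrA.
Qed.

(** Lidskii's inequality with the roles of the matrices changed: there is M with
    M^T M = S2^-1 and M^T diag(y) M = L L^T, so the ratios of the eigenvalues a of
    L L^T to the eigenvalues 1 / b of S2^-1 are bounded by the y.  Both a and 1 / b
    are in descending order, but the products a * b are not; p sorts them. *)
Lemma sum_spectral_cost_le_opposite c L S2 a b y : 0 < c -> L \in unitmx ->
  antitone a -> (forall i j : 'I_n, (i <= j)%N -> b i <= b j) -> antitone y ->
  (forall i, 0 < b i) ->
  has_spectrum (L *m L^T) a -> has_spectrum S2 b -> has_spectrum (L^T *m S2 *m L) y ->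
  \sum_i spectral_cost c (y i) <= \sum_i spectral_cost c (a i * b i).
Proof.
move=> c0 Lu a_anti b_mono y_anti b0 La S2b LS2y.
have LTu : L^T \in unitmx by rewrite unitmx_tr.
have a0 : forall i, 0 < a i.
  by apply/(posdef_spectrum La); have := posdef_gram LTu; rewrite trmxK.
have S2_pos : posdefmx S2 by apply/(posdef_spectrum S2b).
have y0 : forall i, 0 < y i by apply/(posdef_spectrum LS2y); exact: posdef_conj.
have [V Vo LE] := LS2y.
pose D := diag_of (fun i => (Num.sqrt (y i))^-1); pose M := D *m V *m L^T.
have DyD : D *m diag_of y *m D = 1%:M.
  rewrite /D !diag_ofM -diag_of1; apply: eq_diag_of => i.
  have : Num.sqrt (y i) != 0 by rewrite gt_eqF// sqrtr_gt0.
  have : y i = Num.sqrt (y i) ^+ 2 by rewrite sqr_sqrtr// ltW.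
  by move: (Num.sqrt _) => r -> r0; field.
have Du : D \in unitmx by have [_] := mulmx1_unit DyD.
have Mu : M \in unitmx by rewrite !unitmx_mul Du LTu orthogonal_unitmx.
have MT : M^T = L *m V^T *m D by rewrite /M !trmx_mul trmxK diag_ofT mulmxA.
have MyM : M^T *m diag_of y *m M = L *m L^T.
  have -> : M^T *m diag_of y *m M = L *m V^T *m (D *m diag_of y *m D) *m V *m L^T.
    by rewrite MT /M !mulmxA.
  rewrite DyD mulmx1.
  by rewrite -(mulmxA L) Vo mulmx1.
have MM : M^T *m M = invmx S2.
  apply/esym/invmx_eq; have DD : D *m D = diag_of (fun i => (y i)^-1).
    by rewrite /D diag_ofM; apply: eq_diag_of => i; rewrite -invfM -expr2 sqr_sqrtr// ltW.
  have -> : M^T *m M = L *m (V^T *m diag_of (fun i => (y i)^-1) *m V) *m L^T.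
    by rewrite MT /M -DD !mulmxA.
  have -> : V^T *m diag_of (fun i => (y i)^-1) *m V = invmx (L^T *m S2 *m L).
    apply/esym/invmx_eq; rewrite LE !mulmxA -(mulmxA _ V) orthogonal_mxC// mulmx1.
    by rewrite -(mulmxA V^T) diag_of_mulV ?mulmx1// => i; rewrite gt_eqF.
  apply: (can_inj (mulKmx LTu)); rewrite mulmx1 !mulmxA mulmxV ?mul1mx//.
  by rewrite !unitmx_mul LTu Lu posdef_unitmx.
have z0 i : 0 < a i * b i by rewrite mulr_gt0.
have [p zp_anti] := antitone_perm (fun i => a i * b i).
rewrite [leRHS](reindex_inj (@perm_inj _ p)) /=.
apply: (@sum_spectral_cost_le _ c n y (fun i => a (p i) * b (p i))) => // k.
have invb_anti : antitone (fun i => (b i)^-1).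
  by move=> i j ij; rewrite lef_pV2 ?posrE// b_mono.
have MMb : has_spectrum (M^T *m M) (fun i => (b i)^-1).
  by rewrite MM; exact: has_spectrum_invmx.
have MyMa : has_spectrum (M^T *m diag_of y *m M) a by rewrite MyM.
have := lidskii_mul p k Mu invb_anti y_anti a_anti y0 MMb (has_spectrum_diag_of y) MyMa.
rewrite -subr_le0 -sumrB; congr (_ <= 0); apply: eq_bigr => i _.
by rewrite lnV ?posrE// opprK lnM ?posrE.
Qed.

End optimal_covariance.

Section isospectral_class.

Variables (R : realType) (n : nat) (s : n.-tuple R).
Hypothesis s_gt0 : forall x, x \in s -> 0 < x.

Lemma nth_perm_gt0 (t : seq R) (i : 'I_n) : perm_eq t s -> 0 < t`_i.
Proof.
move=> ts; apply: s_gt0; rewrite -(perm_mem ts) mem_nth//.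
by rewrite (perm_size ts) size_tuple.
Qed.

Lemma isospectral_posdef_conj (G : 'M[R]_n) (t : seq R) : orthogonal_mx G ->
  perm_eq t s -> isospectral_posdef s (G^T *m diag_of (fun i => t`_i) *m G).
Proof.
move=> Go ts; have Gt : has_spectrum (G^T *m diag_of (fun i => t`_i) *m G) (fun i => t`_i).
  by exists G.
split; first by apply/(posdef_spectrum Gt) => i; exact: nth_perm_gt0.
rewrite /eigenvalues_of (char_poly_spectrum Gt) -(perm_big _ ts) /=.
by rewrite (big_nth 0) big_mkord (perm_size ts) size_tuple.
Qed.

Lemma isospectral_has_spectrum (S : 'M[R]_n) (t : seq R) : isospectral_posdef s S ->
  perm_eq t s -> has_spectrum S (fun i => t`_i).
Proof. by move=> [[ST _] Ss]; exact: eigenvalues_has_spectrum. Qed.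

Lemma monotone_asc (i j : 'I_n) : (i <= j)%N ->
  (sort <=%R s)`_i <= (sort <=%R s)`_j.
Proof.
apply: (sorted_leq_nth le_trans (@lexx _ R) 0 (sort_sorted (@le_total _ R) s));
  by rewrite inE size_sort size_tuple.
Qed.

End isospectral_class.

Theorem corollary3p3p2 (R : realType) (n : nat) (m1 m2 : 'cV[R]_n)
    (S1 G : 'M[R]_n) (s1 s2 : n.-tuple R)
    (S1_posdef : posdefmx S1) (S1_eig : eigenvalues_of S1 s1)
    (G_ortho : orthogonal_mx G) (S1_diag : S1 = G^T *m diag_desc s1 *m G)
    (s2_gt0 : forall x, x \in s2 -> 0 < x) :
  [/\ forall lambda : R, 0 < lambda ->
        minimizes (fun S2 => eot_cost lambda (gauss m1 S1) (gauss m2 S2))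
          (isospectral_posdef s2) (G^T *m diag_desc s2 *m G),
      forall lambda : R, 0 < lambda ->
        maximizes (fun S2 => eot_cost lambda (gauss m1 S1) (gauss m2 S2))
          (isospectral_posdef s2) (G^T *m diag_asc s2 *m G)
    & exists Smin Smax : 'M[R]_n, forall lambda : R, 0 < lambda ->
        minimizes (fun S2 => eot_cost lambda (gauss m1 S1) (gauss m2 S2))
          (isospectral_posdef s2) Smin /\
        maximizes (fun S2 => eot_cost lambda (gauss m1 S1) (gauss m2 S2))
          (isospectral_posdef s2) Smax].
Proof.
set a := fun i : 'I_n => (sort >=%R s1)`_i.
set bd := fun i : 'I_n => (sort >=%R s2)`_i.
set ba := fun i : 'I_n => (sort <=%R s2)`_i.
have sd : perm_eq (sort >=%R s2) s2 by rewrite perm_sort.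
have sa : perm_eq (sort <=%R s2) s2 by rewrite perm_sort.
have S1a : has_spectrum S1 a by exists G.
have a_gt0 : forall i, 0 < a i by apply/(posdef_spectrum S1a).
have bd_gt0 i : 0 < bd i by exact: (nth_perm_gt0 s2_gt0 i sd).
have ba_gt0 i : 0 < ba i by exact: (nth_perm_gt0 s2_gt0 i sa).
pose r := diag_of (fun i => Num.sqrt (a i)); pose L := G^T *m r.
have rr : r *m r = diag_of a.
  by rewrite /r diag_ofM; apply: eq_diag_of => i; rewrite -expr2 sqr_sqrtr// ltW.
have LLT : L *m L^T = S1.
  by rewrite S1_diag /L trmx_mul trmxK diag_ofT mulmxA -(mulmxA G^T) rr.
have Lu : L \in unitmx.
  have := posdef_unitmx S1_posdef; rewrite -LLT unitmx_mul => /andP[].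
  by [].
have conj_spectrum b : has_spectrum (L^T *m (G^T *m diag_of b *m G) *m L) (fun i => a i * b i).
  have -> : L^T *m (G^T *m diag_of b *m G) *m L =
      r *m (G *m G^T) *m diag_of b *m (G *m G^T) *m r.
    by rewrite /L trmx_mul trmxK diag_ofT !mulmxA.
  rewrite orthogonal_mxC// !mulmx1 !diag_ofM (_ : diag_of _ = diag_of (fun i => a i * b i)).
    exact: has_spectrum_diag_of.
  by apply: eq_diag_of => i; rewrite mulrAC -expr2 sqr_sqrtr// ltW.
have LTL : has_spectrum (L^T *m L) a.
  rewrite /L trmx_mul trmxK diag_ofT mulmxA -(mulmxA r) orthogonal_mxC// mulmx1 rr.
  exact: has_spectrum_diag_of.
(* On the class the trace is constant, so only the spectral term varies. *)
have costE lambda S y : 0 < lambda -> isospectral_posdef s2 S ->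
    has_spectrum (L^T *m S *m L) y ->
    eot_cost lambda (gauss m1 S1) (gauss m2 S) =
    (\tr S1 + \sum_i bd i + eot_shift lambda m1 m2 +
      2 * lambda * \sum_i spectral_cost (2 * lambda)^-1 (y i))%:E.
  move=> l0 Ss Sy; rewrite -LLT (eot_cost_gauss _ _ l0 Lu _ Sy); last by case: Ss.
  by rewrite (trace_spectrum (isospectral_has_spectrum Ss sd)).
have c_gt0 lambda : 0 < lambda -> 0 < (2 * lambda)^-1 :> R.
  by move=> l0; rewrite invr_gt0 mulr_gt0.
have LSL_sym S : isospectral_posdef s2 S -> (L^T *m S *m L)^T = L^T *m S *m L.
  by move=> [[ST _] _]; exact: trmx_conj_sym.
have dclass := isospectral_posdef_conj s2_gt0 G_ortho sd.
have aclass := isospectral_posdef_conj s2_gt0 G_ortho sa.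
have eq_le_eq (x y x' y' : \bar R) : x = x' -> y = y' -> (x' <= y')%E -> (x <= y)%E.
  by move=> -> ->.
have min_desc lambda : 0 < lambda ->
    minimizes (fun S2 => eot_cost lambda (gauss m1 S1) (gauss m2 S2))
      (isospectral_posdef s2) (G^T *m diag_desc s2 *m G).
  move=> l0; split; first exact: dclass.
  move=> S Ss; have [y y_anti Sy] := sym_spectrum (LSL_sym S Ss).
  cbv beta; apply: (eq_le_eq _ _ _ _
    (costE _ _ _ l0 dclass (conj_spectrum bd)) (costE _ _ _ l0 Ss Sy)).
  rewrite lee_fin lerD2l ler_pM2l ?mulr_gt0//.
  apply: (sum_spectral_cost_ge (c_gt0 _ l0) Lu _ _ y_anti bd_gt0 LTL _ Sy).
  - exact: antitone_desc.
  - exact: antitone_desc.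
  - exact: (isospectral_has_spectrum Ss sd).
have max_asc lambda : 0 < lambda ->
    maximizes (fun S2 => eot_cost lambda (gauss m1 S1) (gauss m2 S2))
      (isospectral_posdef s2) (G^T *m diag_asc s2 *m G).
  move=> l0; split; first exact: aclass.
  move=> S Ss; have [y y_anti Sy] := sym_spectrum (LSL_sym S Ss).
  cbv beta; apply: (eq_le_eq _ _ _ _
    (costE _ _ _ l0 Ss Sy) (costE _ _ _ l0 aclass (conj_spectrum ba))).
  rewrite lee_fin lerD2l ler_pM2l ?mulr_gt0//.
  apply: (sum_spectral_cost_le_opposite (c_gt0 _ l0) Lu _ _ y_anti ba_gt0 _ _ Sy).
  - exact: antitone_desc.
  - exact: monotone_asc.
  - by rewrite LLT.
  - exact: (isospectral_has_spectrum Ss sa).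
split; [exact: min_desc|exact: max_asc|].
exists (G^T *m diag_desc s2 *m G), (G^T *m diag_asc s2 *m G) => lambda l0.
by split; [exact: min_desc|exact: max_asc].
Qed.
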